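(* Let $C,B$ be weakly dual Hopf algebras over a field $\Bbbk$, let $\sigma\in C^2(B,\Bbbk)$ and $\tau\in C^2({}^{\mathrm{cop}}C,\Bbbk)$ (equivalently, $\tau$ is a left $2$-cocycle over $C$). Then $\sigma\circ\tau\in C^2(\mathrm{Drin}_{\Bbbk}(C,B),\Bbbk)$, where for $b,b'\in B$ and $c,c'\in C$ $$(\sigma\circ\tau)(bc,b'c')=\sigma(b,b'_{(2)})\,\tau(c_{(1)},c')\,\mathrm{ev}(c_{(2)},b'_{(1)}).$$ The right twist of $\mathrm{Drin}_{\Bbbk}(C,B)$ by $\sigma\circ\tau$ gives an algebra defined on the $\Bbbk$-vector space $B\otimes C$ with the product $$m_{\sigma\circ\tau}(bc,b'c')=m_\sigma(b,b'_{(2)})\otimes m_\tau(c_{(1)},c')\,\mathrm{ev}(c_{(2)},b'_{(1)}),$$ where $m_\sigma(b,b')=b_{(1)}b'_{(1)}\sigma(b_{(2)},b'_{(2)})$ and $m_\tau(c,c')=c_{(2)}c'_{(2)}\tau(c_{(1)},c'_{(1)})$.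
   Context: Sweedler notation with implicit sums; all Hopf algebras have invertible antipode. ${}^{\mathrm{cop}}C$ is $C$ with the same product and opposite coproduct $c\mapsto c_{(2)}\otimes c_{(1)}$; $c_{(1)}\otimes c_{(2)}$ always denotes the coproduct of $C$. Weakly dual Hopf algebras $C,B$ over $\Bbbk$: there is a linear map $\mathrm{ev}\colon C\otimes B\to\Bbbk$ (not necessarily non-degenerate) with $\mathrm{ev}(cc',b)=\mathrm{ev}(c,b_{(2)})\mathrm{ev}(c',b_{(1)})$, $\mathrm{ev}(c,bb')=\mathrm{ev}(c_{(2)},b)\mathrm{ev}(c_{(1)},b')$, $\mathrm{ev}(1,b)=\varepsilon(b)$, $\mathrm{ev}(c,1)=\varepsilon(c)$, $\mathrm{ev}(Sc,b)=\mathrm{ev}(c,Sb)$. $\mathrm{Drin}_{\Bbbk}(C,B)$ is the $\Bbbk$-Hopf algebra generated by $C$ and $B$ as subalgebras with relations $b_{(2)}c_{(1)}\mathrm{ev}(c_{(2)},b_{(1)})=c_{(2)}b_{(1)}\mathrm{ev}(c_{(1)},b_{(2)})$, coproduct $\Delta(b)=b_{(1)}\otimes b_{(2)}$, $\Delta(c)=c_{(2)}\otimes c_{(1)}$, and counit extending those of $C$ and $B$ multiplicatively. As a vector space it is identified with $B\otimes C$ via $b\otimes c\mapsto bc$. For a bialgebra $E$ over $\Bbbk$, $C^2(E,\Bbbk)$ is the set of right $2$-cocycles: convolution-invertible linear maps $\sigma\colon E\otimes E\to\Bbbk$ with $\sigma(h\otimes k_{(1)}l_{(1)})\sigma(k_{(2)}\otimes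 l_{(2)})=\sigma(h_{(1)}k_{(1)}\otimes l)\sigma(h_{(2)}\otimes k_{(2)})$ and $\sigma(h\otimes 1)=\sigma(1\otimes h)=\varepsilon(h)$. A left $2$-cocycle satisfies instead $\sigma(h_{(1)},k_{(1)})\sigma(h_{(2)}k_{(2)},l)=\sigma(k_{(1)},l_{(1)})\sigma(h,k_{(2)}l_{(2)})$, with the same normalization and invertibility. The right twist of $E$ by $\sigma\in C^2(E,\Bbbk)$ is the vector space $E$ with product $g\cdot_\sigma h=g_{(1)}h_{(1)}\sigma(g_{(2)},h_{(2)})$. *)

(* Defs.v *)
From HB Require Import structures.
From mathcomp Require Import all_boot all_algebra.
From mathcomp Require Import boolp.

Set Implicit Arguments.
Unset Strict Implicit.
Unset Printing Implicit Defensive.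

Import GRing.Theory.
Local Open Scope ring_scope.
Local Open Scope quotient_scope.

Definition bilin (k : fieldType) (U V W : lmodType k) (f : U -> V -> W) : Prop :=
  (forall v, linear (f^~ v)) /\ (forall u, linear (f u)).

Definition biform (k : fieldType) (U V : lmodType k) (f : U -> V -> k) : Prop :=
  @bilin k U V k^o f.

Section Tensor.
Variables (k : fieldType) (U V : lmodType k).

(* The list [:: (u1, v1); ...; (un, vn)] stands for u1 ⊗ v1 + ... + un ⊗ vn. *)
Inductive tcong : seq (U * V) -> seq (U * V) -> Prop :=
| tcong_refl s : tcong s s
| tcong_sym s t : tcong s t -> tcong t s
| tcong_trans s t r : tcong s t -> tcong t r -> tcong s r
| tcong_cat s s' t t' : tcong s s' -> tcong t t' -> tcong (s ++ t) (s' ++ t')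
| tcong_catC s t : tcong (s ++ t) (t ++ s)
| tcong_0l v : tcong [:: (0, v)] [::]
| tcong_addl u u' v : tcong [:: (u + u', v)] [:: (u, v); (u', v)]
| tcong_addr u v v' : tcong [:: (u, v + v')] [:: (u, v); (u, v')]
| tcong_scale a u v : tcong [:: (a *: u, v)] [:: (u, a *: v)].

Definition tcongb (s t : seq (U * V)) : bool := `[< tcong s t >].

Lemma tcongb_equiv : equiv_class_of tcongb.
Proof.
split.
- by move=> s; apply/asboolP; exact: tcong_refl.
- by move=> s t; apply/asboolP/asboolP; exact: tcong_sym.
- move=> s t r /asboolP h1 /asboolP h2; apply/asboolP.
  exact: tcong_trans h1 h2.
Qed.

Canonical tcong_equivRel := EquivRelPack tcongb_equiv.

Definition tens := {eq_quot tcongb}.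
HB.instance Definition _ := Choice.on tens.
HB.instance Definition _ := EqQuotient.on tens.

Lemma tensP (s t : seq (U * V)) : tcong s t -> \pi_tens s = \pi_tens t.
Proof. by move=> h; apply/eqmodP/asboolP. Qed.

Lemma tens_reprP (s : seq (U * V)) : tcong (repr (\pi_tens s)) s.
Proof.
by apply/asboolP; have /eqmodP := reprK (\pi_tens s).
Qed.

Definition tens0 : tens := \pi_tens [::].
Definition tens_add (x y : tens) : tens := \pi_tens (repr x ++ repr y).
Definition tens_scale (a : k) (x : tens) : tens :=
  \pi_tens [seq (a *: p.1, p.2) | p <- repr x].
Definition tens_opp : tens -> tens := tens_scale (-1).

Lemma tens_addE s t : tens_add (\pi_tens s) (\pi_tens t) = \pi_tens (s ++ t).
Proof. by apply: tensP; apply: tcong_cat; exact: tens_reprP. Qed.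

Lemma tcong_map a s t : tcong s t ->
  tcong [seq (a *: p.1, p.2) | p <- s] [seq (a *: p.1, p.2) | p <- t].
Proof.
elim=> {s t}.
- by move=> s; apply: tcong_refl.
- by move=> s t _; apply: tcong_sym.
- by move=> s t r _ h1 _; apply: tcong_trans.
- by move=> s s' t t' _ h1 _ h2; rewrite !map_cat; apply: tcong_cat.
- by move=> s t; rewrite !map_cat; apply: tcong_catC.
- by move=> v /=; rewrite scaler0; apply: tcong_0l.
- by move=> u u' v /=; rewrite scalerDr; apply: tcong_addl.
- by move=> u v v' /=; apply: tcong_addr.
- by move=> b u v /=; rewrite scalerA mulrC -scalerA; apply: tcong_scale.
Qed.

Lemma tens_scaleE a s : tens_scale a (\pi_tens s) = \pi_tens [seq (a *: p.1, p.2) | p <- s].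
Proof. by apply: tensP; apply: tcong_map; exact: tens_reprP. Qed.

Lemma tens_ind_pi (P : tens -> Prop) : (forall s, P (\pi_tens s)) -> forall x, P x.
Proof. by move=> h x; rewrite -[x]reprK. Qed.

Lemma tens_addA : associative tens_add.
Proof.
elim/tens_ind_pi=> s; elim/tens_ind_pi=> t; elim/tens_ind_pi=> r.
by rewrite !tens_addE catA.
Qed.

Lemma tens_addC : commutative tens_add.
Proof.
elim/tens_ind_pi=> s; elim/tens_ind_pi=> t.
by rewrite !tens_addE; apply: tensP; apply: tcong_catC.
Qed.

Lemma tens_add0 : left_id tens0 tens_add.
Proof. by elim/tens_ind_pi=> s; rewrite tens_addE. Qed.

Lemma tens_scaleA a b x : tens_scale a (tens_scale b x) = tens_scale (a * b) x.
Proof.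
elim/tens_ind_pi: x => s; rewrite !tens_scaleE -map_comp /=; congr (\pi_tens _).
by apply: eq_map => p /=; rewrite scalerA.
Qed.

Lemma tens_scale1 : left_id 1 tens_scale.
Proof.
elim/tens_ind_pi=> s; rewrite tens_scaleE; congr (\pi_tens _).
by rewrite -[RHS]map_id; apply: eq_map => -[u v] /=; rewrite scale1r.
Qed.

Lemma tens_scaleDr : right_distributive tens_scale tens_add.
Proof.
move=> a; elim/tens_ind_pi=> s; elim/tens_ind_pi=> t.
by rewrite (tens_addE s t) !tens_scaleE tens_addE map_cat.
Qed.

Lemma tens_scaleDl x a b :
  tens_scale (a + b) x = tens_add (tens_scale a x) (tens_scale b x).
Proof.
elim/tens_ind_pi: x => s; rewrite !tens_scaleE tens_addE; apply: tensP.
elim: s => [|[u v] s ih] /=; first exact: tcong_refl.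
rewrite scalerDl.
apply: (tcong_trans (tcong_cat (tcong_addl (a *: u) (b *: u) v) ih)).
rewrite /= -[_ :: _ :: _]cat1s -[(a *: u, v) :: map _ _ ++ _]cat1s.
apply: tcong_cat; first exact: tcong_refl.
rewrite -cat1s catA [X in tcong _ X](_ : _ =
  ([seq (a *: p.1, p.2) | p <- s] ++ [:: (b *: u, v)]) ++
  [seq (b *: p.1, p.2) | p <- s]); last by rewrite -catA.
by apply: tcong_cat; [apply: tcong_catC | apply: tcong_refl].
Qed.

Lemma tens_scale0 x : tens_scale 0 x = tens0.
Proof.
elim/tens_ind_pi: x => s; rewrite tens_scaleE; apply: tensP.
elim: s => [|[u v] s ih] /=; first exact: tcong_refl.
by rewrite scale0r -cat1s; apply: (tcong_cat (tcong_0l v) ih).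
Qed.

Lemma tens_addN : left_inverse tens0 tens_opp tens_add.
Proof.
move=> x; rewrite -{2}[x]tens_scale1 /tens_opp -tens_scaleDl addNr.
exact: tens_scale0.
Qed.

HB.instance Definition _ :=
  GRing.isZmodule.Build tens tens_addA tens_addC tens_add0 tens_addN.
HB.instance Definition _ :=
  GRing.Zmodule_isLmodule.Build k tens tens_scaleA tens_scale1
    tens_scaleDr tens_scaleDl.

Definition tpure (u : U) (v : V) : tens := \pi_tens [:: (u, v)].

(* Sweedler sum: the value of f at t is the sum of f u v over a chosen
   expression of t as a finite sum of pure tensors u ⊗ v. It does not depend on
   the choice when f is bilinear, which is the only case that is used. *)
Definition sweedler (W : nmodType) (f : U -> V -> W) (t : tens) : W :=
  \sum_(p <- repr t) f p.1 p.2.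

End Tensor.

Notation "u ⊗ v" := (tpure u v) (at level 41, right associativity) : ring_scope.
Notation "'\sw_' ( x , y <- t ) F" := (sweedler (fun x y => F) t)
  (at level 41, x name, y name, t at level 99, F at level 41, right associativity,
   format "'\sw_' ( x ,  y  <-  t )  F") : ring_scope.

Section TensorTheory.
Variables (k : fieldType).
Implicit Types U V W : lmodType k.

Definition lin U W (f : U -> W) : Prop := linear f.

Lemma linD U W (f : U -> W) : lin f -> forall x y, f (x + y) = f x + f y.
Proof. by move=> h x y; rewrite -[x]scale1r h !scale1r. Qed.
Lemma lin0 U W (f : U -> W) : lin f -> f 0 = 0.
Proof. by move=> h; apply: (addIr (f 0)); rewrite -linD // !add0r. Qed.
Lemma linZ U W (f : U -> W) : lin f -> forall a x, f (a *: x) = a *: f x.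
Proof. by move=> h a x; rewrite -[a *: x]addr0 h lin0 ?addr0. Qed.
Lemma lin_sum U W (f : U -> W) : lin f ->
  forall I (r : seq I) (F : I -> U), f (\sum_(i <- r) F i) = \sum_(i <- r) f (F i).
Proof.
move=> h I r F; elim: r => [|i r ih]; first by rewrite !big_nil lin0.
by rewrite !big_cons linD // ih.
Qed.
Lemma lin_sw U V (W W' : lmodType k) (L : W -> W') (f : U -> V -> W) t : lin L ->
  L (\sw_(u, v <- t) f u v) = \sw_(u, v <- t) L (f u v).
Proof. by move=> h; rewrite /sweedler lin_sum. Qed.

Lemma tens_piD U V (s t : seq (U * V)) :
  \pi_(tens U V) (s ++ t) = (\pi_(tens U V) s : tens U V) + (\pi_(tens U V) t : tens U V).
Proof. by rewrite -tens_addE. Qed.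

Lemma tens_piE U V (s : seq (U * V)) :
  \pi_(tens U V) s = \sum_(p <- s) p.1 ⊗ p.2 :> tens U V.
Proof.
elim: s => [|[u v] s ih]; first by rewrite big_nil.
by rewrite big_cons -cat1s tens_piD ih.
Qed.

Lemma tpure_bilin U V : bilin (@tpure k U V).
Proof.
have scl a (u : U) (v : V) : (a *: u) ⊗ v = a *: (u ⊗ v).
  by rewrite [RHS]tens_scaleE.
have scr a (u : U) (v : V) : u ⊗ (a *: v) = a *: (u ⊗ v).
  by rewrite -scl; apply: tensP; apply: tcong_sym; apply: tcong_scale.
split.
- move=> v a u u' /=; rewrite -scl -[RHS]tens_piD /=.
  by apply: tensP; apply: tcong_addl.
- move=> u a v v' /=; rewrite -scr -[RHS]tens_piD /=.
  by apply: tensP; apply: tcong_addr.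
Qed.

Lemma bilinl U V W (f : U -> V -> W) : bilin f -> forall v, lin (f^~ v).
Proof. by case. Qed.
Lemma bilinr U V W (f : U -> V -> W) : bilin f -> forall u, lin (f u).
Proof. by case. Qed.

Lemma tcong_sum U V W (f : U -> V -> W) s t : bilin f -> tcong s t ->
  \sum_(p <- s) f p.1 p.2 = \sum_(p <- t) f p.1 p.2.
Proof.
move=> bf; elim=> {s t}.
- by [].
- by [].
- by move=> s t r _ -> _ ->.
- by move=> s s' t t' _ h1 _ h2; rewrite !big_cat /= h1 h2.
- by move=> s t; rewrite !big_cat /= addrC.
- by move=> v; rewrite big_seq1 big_nil /= (lin0 (bilinl bf v)).
- move=> u u' v; rewrite big_seq1 big_cons big_seq1 /=.
  exact: (linD (bilinl bf v)).
- move=> u v v'; rewrite big_seq1 big_cons big_seq1 /=.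
  exact: (linD (bilinr bf u)).
- move=> a u v; rewrite !big_seq1 /=.
  by rewrite (linZ (bilinl bf v)) (linZ (bilinr bf u)).
Qed.

Lemma sw_pi U V W (f : U -> V -> W) s : bilin f ->
  sweedler f (\pi_(tens U V) s) = \sum_(p <- s) f p.1 p.2.
Proof. by move=> bf; apply: (tcong_sum bf); exact: tens_reprP. Qed.

Lemma sw_lin U V W (f : U -> V -> W) : bilin f -> lin (sweedler f).
Proof.
move=> bf a x y; rewrite -[x]reprK -[y]reprK [_ *: _]tens_scaleE -tens_piD.
rewrite !sw_pi // big_cat big_map /= scaler_sumr; congr (_ + _).
by apply: eq_bigr => p _; rewrite (linZ (bilinl bf _)).
Qed.

Lemma sw_pure U V W (f : U -> V -> W) u v : bilin f -> sweedler f (u ⊗ v) = f u v.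
Proof. by move=> bf; rewrite sw_pi // big_seq1. Qed.

Lemma sw_id U V (t : tens U V) : \sw_(u, v <- t) u ⊗ v = t.
Proof. by rewrite /sweedler -tens_piE reprK. Qed.

Lemma eq_sw U V (W : nmodType) (f g : U -> V -> W) t :
  (forall u v, f u v = g u v) -> sweedler f t = sweedler g t.
Proof. by move=> h; apply: eq_bigr => p _. Qed.

Lemma exch_sw U V U' V' (W : nmodType) (f : U -> V -> U' -> V' -> W) s t :
  \sw_(u, v <- s) \sw_(u', v' <- t) f u v u' v' =
  \sw_(u', v' <- t) \sw_(u, v <- s) f u v u' v'.
Proof. exact: exchange_big. Qed.

Lemma swZ U V W (f : U -> V -> W) a t :
  \sw_(u, v <- t) a *: f u v = a *: \sw_(u, v <- t) f u v.
Proof. by rewrite /sweedler scaler_sumr. Qed.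

Lemma tens_eqP U V W (f g : tens U V -> W) : lin f -> lin g ->
  (forall u v, f (u ⊗ v) = g (u ⊗ v)) -> f =1 g.
Proof.
move=> lf lg h t; rewrite -[t]sw_id (lin_sw _ _ lf) (lin_sw _ _ lg).
by apply: eq_sw.
Qed.

End TensorTheory.

HB.mixin Record Lmodule_isCoalgebra (k : fieldType) V of GRing.Lmodule k V := {
  comul : V -> tens V V;
  counit : V -> k;
  comul_linear : linear comul;
  counit_linear : scalar counit;
  comulA : forall x,
    \sw_(a, b <- comul x) \sw_(a1, a2 <- comul a) a1 ⊗ (a2 ⊗ b) =
    \sw_(a, b <- comul x) \sw_(b1, b2 <- comul b) a ⊗ (b1 ⊗ b2)
      :> tens V (tens V V);
  counitl : forall x, \sw_(a, b <- comul x) counit a *: b = x;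
  counitr : forall x, \sw_(a, b <- comul x) counit b *: a = x
}.
#[short(type="coalgType")]
HB.structure Definition Coalgebra (k : fieldType) :=
  { V of GRing.Lmodule k V & Lmodule_isCoalgebra k V }.

Notation Δ := comul.
Notation ε := counit.

HB.mixin Record isBialgebra (k : fieldType) E
    of GRing.Algebra k E & Coalgebra k E := {
  comul1 : Δ (1 : E) = 1 ⊗ 1;
  comulM : forall x y : E, Δ (x * y) =
    \sw_(x1, x2 <- Δ x) \sw_(y1, y2 <- Δ y) (x1 * y1) ⊗ (x2 * y2);
  counit1 : ε (1 : E) = 1 :> k;
  counitM : forall x y : E, ε (x * y) = ε x * ε y :> k
}.
#[short(type="bialgType")]
HB.structure Definition Bialgebra (k : fieldType) :=
  { E of GRing.Algebra k E & Coalgebra k E & isBialgebra k E }.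

HB.mixin Record isHopf (k : fieldType) H of Bialgebra k H := {
  antipode : H -> H;
  antipode_linear : linear antipode;
  antipodel : forall x : H,
    \sw_(x1, x2 <- Δ x) antipode x1 * x2 = (ε x : k) *: 1;
  antipoder : forall x : H,
    \sw_(x1, x2 <- Δ x) x1 * antipode x2 = (ε x : k) *: 1;
  antipode_bij : bijective antipode
}.
#[short(type="hopfType")]
HB.structure Definition Hopf (k : fieldType) := { H of Bialgebra k H & isHopf k H }.

Section LinRules.
Variable k : fieldType.
Implicit Types U V W : lmodType k.

Lemma lin_id U : lin (fun x : U => x). Proof. by []. Qed.
Lemma lin_cmp U V W (f : V -> W) (g : U -> V) :
  lin f -> lin g -> lin (fun x => f (g x)).
Proof. by move=> hf hg a x y; rewrite hg hf. Qed.
Lemma lin_bil U V V' W (f : V -> V' -> W) (g : U -> V) c :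
  bilin f -> lin g -> lin (fun x => f (g x) c).
Proof. by move=> hf hg a x y; rewrite hg (bilinl hf). Qed.
Lemma lin_bir U V V' W (f : V' -> V -> W) (g : U -> V) c :
  bilin f -> lin g -> lin (fun x => f c (g x)).
Proof. by move=> hf hg a x y; rewrite hg (bilinr hf). Qed.
Lemma lin_add U W (f g : U -> W) : lin f -> lin g -> lin (fun x => f x + g x).
Proof. by move=> hf hg a x y; rewrite hg hf scalerDr addrACA. Qed.
Lemma lin_zr U W a (g : U -> W) : lin g -> lin (fun x => a *: g x).
Proof. by move=> hg b x y; rewrite hg scalerDr !scalerA mulrC. Qed.
Lemma lin_zl U W (g : U -> k) (w : W) :
  @lin k U k^o g -> lin (fun x => g x *: w).
Proof. by move=> hg b x y; rewrite hg scalerDl -scalerA. Qed.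
Lemma lin_mr U (A : algType k) a (g : U -> A) : lin g -> lin (fun x => a * g x).
Proof. by move=> hg b x y; rewrite hg mulrDr scalerAr. Qed.
Lemma lin_ml U (A : algType k) a (g : U -> A) : lin g -> lin (fun x => g x * a).
Proof. by move=> hg b x y; rewrite hg mulrDl scalerAl. Qed.
Lemma lin_kr U a (g : U -> k) :
  @lin k U k^o g -> @lin k U k^o (fun x => a * g x).
Proof. by move=> hg b x y; rewrite hg mulrDr; congr (_ + _); apply: mulrCA. Qed.
Lemma lin_kl U a (g : U -> k) :
  @lin k U k^o g -> @lin k U k^o (fun x => g x * a).
Proof. by move=> hg b x y; rewrite hg mulrDl; congr (_ + _); rewrite -mulrA. Qed.
Lemma lin_swf U V V' W (F : U -> V -> V' -> W) t :
  (forall u v, lin (fun x => F x u v)) -> lin (fun x => sweedler (F x) t).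
Proof.
move=> h a x y; rewrite /sweedler scaler_sumr -big_split /=.
by apply: eq_bigr => p _; apply: h.
Qed.
Lemma lin_swfk U V V' (F : U -> V -> V' -> k) t :
  (forall u v, @lin k U k^o (fun x => F x u v)) ->
  @lin k U k^o (fun x => sweedler (F x) t).
Proof. exact: (@lin_swf U V V' k^o). Qed.
Lemma lin_swt U V V' W (f : V -> V' -> W) (g : U -> tens V V') :
  bilin f -> lin g -> lin (fun x => sweedler f (g x)).
Proof. by move=> hf hg; apply: lin_cmp hg; apply: sw_lin. Qed.
Lemma lin_swtk U V V' (f : V -> V' -> k) (g : U -> tens V V') :
  @bilin k V V' k^o f -> lin g -> @lin k U k^o (fun x => sweedler f (g x)).
Proof. exact: (@lin_swt U V V' k^o). Qed.
Lemma lin_bfl U V V' (f : V -> V' -> k) (g : U -> V) c :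
  biform f -> lin g -> @lin k U k^o (fun x => f (g x) c).
Proof. exact: lin_bil. Qed.
Lemma lin_bfr U V V' (f : V' -> V -> k) (g : U -> V) c :
  biform f -> lin g -> @lin k U k^o (fun x => f c (g x)).
Proof. exact: lin_bir. Qed.
Lemma lin_comul (C : coalgType k) : lin (@comul k C).
Proof. exact: comul_linear. Qed.
Lemma lin_counit (C : coalgType k) : @lin k C k^o (@counit k C).
Proof. exact: counit_linear. Qed.
Lemma lin_antipode (H : hopfType k) : lin (@antipode k H).
Proof. exact: antipode_linear. Qed.
Lemma bilinI U V W (f : U -> V -> W) :
  (forall v, lin (fun u => f u v)) -> (forall u, lin (fun v => f u v)) -> bilin f.
Proof. by []. Qed.

End LinRules.

Ltac lin_step :=
  cbv beta; match goal with
  | |- forall _, _ => intro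
  | |- bilin _ => eassumption
  | |- bilin _ => apply: bilinI
  | |- biform _ => apply: bilinI
  | |- lin (fun x => x) => exact: lin_id
  | |- lin (fun x => @sweedler _ _ _ _ (@?F x) ?t) =>
      first [apply: lin_swf | apply: lin_swfk]
  | |- lin (fun x => sweedler ?f (@?g x)) =>
      first [apply: (@lin_swt _ _ _ _ _ f g) | apply: (@lin_swtk _ _ _ _ f g)]
  | |- lin (fun x => _ + _) => apply: lin_add
  | |- lin (fun x => ?a *: (@?g x)) => first [apply: (@lin_zr _ _ _ a g) | apply: lin_zr]
  | |- lin (fun x => (@?g x) *: ?w) => apply: (@lin_zl _ _ _ g w)
  | |- lin (fun x => ?a * (@?g x)) =>
      first [apply: (@lin_mr _ _ _ a g) | apply: (@lin_kr _ _ a g)]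
  | |- lin (fun x => (@?g x) * ?w) =>
      first [apply: (@lin_ml _ _ _ w g) | apply: (@lin_kl _ _ w g)]
  | |- lin (fun x => tpure ?a (@?g x)) => apply: (lin_bir (f := @tpure _ _ _) (g := g)); first exact: tpure_bilin
  | |- lin (fun x => tpure (@?g x) ?a) => apply: (lin_bil (f := @tpure _ _ _) (g := g)); first exact: tpure_bilin
  | |- lin (fun x => comul (@?g x)) => apply: (lin_cmp (g := g) (@lin_comul _ _))
  | |- lin (fun x => counit (@?g x)) => apply: (lin_cmp (W := _^o) (g := g) (@lin_counit _ _))
  | |- lin (fun x => antipode (@?g x)) => apply: (lin_cmp (g := g) (@lin_antipode _ _))
  | |- lin _ => solve [eauto 2]
  | h : lin ?f |- lin (fun x => ?f (@?g x)) => apply: (lin_cmp (g := g) h)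
  | h : bilin ?f |- lin (fun x => ?f ?a (@?g x)) => refine (@lin_bir _ _ _ _ _ f g a h _)
  | h : bilin ?f |- lin (fun x => ?f (@?g x) ?a) => refine (@lin_bil _ _ _ _ _ f g a h _)
  | h : biform ?f' |- lin (fun x => ?f ?a (@?g x)) => refine (@lin_bfr _ _ _ _ f g a h _)
  | h : biform ?f' |- lin (fun x => ?f (@?g x) ?a) => refine (@lin_bfl _ _ _ _ f g a h _)
  end.
Ltac lin_tac := repeat lin_step.

Definition trilin (k : fieldType) (U V V' W : lmodType k)
    (F : U -> V -> V' -> W) : Prop :=
  [/\ forall b c, lin (fun a => F a b c), forall a c, lin (fun b => F a b c)
    & forall a b, lin (fun c => F a b c)].

Section Coassociativity.
Variables (k : fieldType) (C : lmodType k) (D : C -> tens C C).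

Definition coassoc_at x :=
  \sw_(a, b <- D x) \sw_(a1, a2 <- D a) a1 ⊗ (a2 ⊗ b) =
  \sw_(a, b <- D x) \sw_(b1, b2 <- D b) a ⊗ (b1 ⊗ b2)
      :> tens C (tens C C).

Lemma coassoc_trilin (W : lmodType k) (F : C -> C -> C -> W) x :
  coassoc_at x -> trilin F ->
  \sw_(a, b <- D x) \sw_(a1, a2 <- D a) F a1 a2 b =
  \sw_(a, b <- D x) \sw_(b1, b2 <- D b) F a b1 b2.
Proof.
move=> cx [F1 F2 F3].
have bF a : bilin (F a) by split=> ?; [apply: F2 | apply: F3].
pose G (a : C) (s : tens C C) := sweedler (F a) s.
have bG : bilin G.
  rewrite /G; apply: bilinI; first by move=> v; apply: lin_swf=> *; exact: F1.
  by move=> u; apply: (@lin_swt _ _ _ _ _ (F u) id).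
transitivity (sweedler G (\sw_(a, b <- D x) \sw_(a1, a2 <- D a) a1 ⊗ (a2 ⊗ b))).
  rewrite (lin_sw _ _ (sw_lin bG)); apply: eq_sw => a b.
  rewrite (lin_sw _ _ (sw_lin bG)); apply: eq_sw => a1 a2.
  by rewrite sw_pure // /G sw_pure.
rewrite cx (lin_sw _ _ (sw_lin bG)); apply: eq_sw => a b.
rewrite (lin_sw _ _ (sw_lin bG)); apply: eq_sw => b1 b2.
by rewrite sw_pure // /G sw_pure.
Qed.

End Coassociativity.

Section CoalgebraTheory.
Variables (k : fieldType) (C : coalgType k).

Lemma sw_comulA (W : lmodType k) (F : C -> C -> C -> W) x : trilin F ->
  \sw_(a, b <- Δ x) \sw_(a1, a2 <- Δ a) F a1 a2 b =
  \sw_(a, b <- Δ x) \sw_(b1, b2 <- Δ b) F a b1 b2.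
Proof. exact/coassoc_trilin/comulA. Qed.

Lemma sw_counitl (W : lmodType k) (f : C -> W) x : lin f ->
  \sw_(a, b <- Δ x) ε a *: f b = f x.
Proof.
move=> lf; rewrite -[in RHS](counitl x) (lin_sw _ _ lf).
by apply: eq_sw => a b; rewrite (linZ lf).
Qed.

Lemma sw_counitr (W : lmodType k) (f : C -> W) x : lin f ->
  \sw_(a, b <- Δ x) ε b *: f a = f x.
Proof.
move=> lf; rewrite -[in RHS](counitr x) (lin_sw _ _ lf).
by apply: eq_sw => a b; rewrite (linZ lf).
Qed.

End CoalgebraTheory.

(* A type alias of C carrying the same algebra and the opposite coproduct, so that
   Δ on cop C is not Δ on C. *)
Definition cop (C : Type) : Type := C.

Section CopCoalgebra.
Variables (k : fieldType) (C : coalgType k).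

HB.instance Definition _ := GRing.Lmodule.on (cop C).

Definition cop_comul (x : cop C) : tens (cop C) (cop C) :=
  \sw_(a, b <- @comul k C x) (b : cop C) ⊗ (a : cop C).

Lemma cop_comul_linear : linear cop_comul.
Proof. by rewrite -/(lin _) /cop_comul; lin_tac. Qed.

Lemma cop_sw (W : lmodType k) (f : C -> C -> W) x : bilin f ->
  sweedler f (cop_comul x) = \sw_(a, b <- @comul k C x) f b a.
Proof.
move=> [f1 f2]; rewrite /cop_comul (lin_sw _ _ (sw_lin (conj f1 f2))).
by apply: eq_sw => a b; rewrite sw_pure.
Qed.

Lemma cop_comulA x :
  \sw_(a, b <- cop_comul x) \sw_(a1, a2 <- cop_comul a) a1 ⊗ (a2 ⊗ b) =
  \sw_(a, b <- cop_comul x) \sw_(b1, b2 <- cop_comul b) a ⊗ (b1 ⊗ b2)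
    :> tens (cop C) (tens (cop C) (cop C)).
Proof.
have lc : @lin k C _ cop_comul by exact: cop_comul_linear.
rewrite (@cop_sw _ (fun a b => \sw_(a1, a2 <- cop_comul a) a1 ⊗ (a2 ⊗ b))); last first.
  by apply: bilinI => ?; lin_tac.
rewrite (@cop_sw _ (fun a b => \sw_(b1, b2 <- cop_comul b) a ⊗ (b1 ⊗ b2))); last first.
  by apply: bilinI => ?; lin_tac.
transitivity (\sw_(a, b <- @comul k C x) \sw_(b1, b2 <- @comul k C b)
    (b2 : cop C) ⊗ ((b1 : cop C) ⊗ (a : cop C))).
  apply: eq_sw => a b; apply: (@cop_sw _ (fun u v : C => u ⊗ (v ⊗ a))).
  by apply: bilinI => ?; lin_tac.
rewrite -(@sw_comulA _ _ _ (fun a b c => c ⊗ (b ⊗ a))); last first.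
  by split=> ? ?; lin_tac.
apply: eq_sw => a b; symmetry; apply: (@cop_sw _ (fun u v : C => b ⊗ (u ⊗ v))).
by apply: bilinI => ?; lin_tac.
Qed.

Lemma cop_counitl x : \sw_(a, b <- cop_comul x) @counit k C a *: b = x.
Proof.
rewrite (@cop_sw _ (fun a b : C => @counit k C a *: b)) ?counitr //.
by apply: bilinI => ?; lin_tac.
Qed.

Lemma cop_counitr x : \sw_(a, b <- cop_comul x) @counit k C b *: a = x.
Proof.
rewrite (@cop_sw _ (fun a b : C => @counit k C b *: a)) ?counitl //.
by apply: bilinI => ?; lin_tac.
Qed.

HB.instance Definition _ := Lmodule_isCoalgebra.Build k (cop C)
  cop_comul_linear (@counit_linear k C) cop_comulA cop_counitl cop_counitr.
End CopCoalgebra.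

Section CopBialgebra.
Variables (k : fieldType) (E : bialgType k).
HB.instance Definition _ := GRing.Algebra.on (cop E).
HB.instance Definition _ := Coalgebra.copy (cop E) (cop (E : coalgType k)).

Lemma cop_comul1 : Δ (1 : cop E) = 1 ⊗ 1.
Proof.
rewrite [LHS](_ : _ = cop_comul (1 : E)) // /cop_comul comul1 sw_pure //.
by apply: bilinI => ?; lin_tac.
Qed.

Lemma cop_comulM (x y : cop E) : Δ (x * y) =
  \sw_(x1, x2 <- Δ x) \sw_(y1, y2 <- Δ y) (x1 * y1) ⊗ (x2 * y2).
Proof.
rewrite (@cop_sw k E _ (fun x1 x2 : E =>
  \sw_(y1, y2 <- cop_comul y) (x1 * y1 : cop E) ⊗ (x2 * y2 : cop E))); last first.
  by apply: bilinI => ?; lin_tac.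
transitivity (cop_comul (x * y : E)); first by [].
rewrite /cop_comul comulM.
have b1 : bilin (fun u v : E => (v : cop E) ⊗ (u : cop E)).
  by apply: bilinI => ?; lin_tac.
rewrite (lin_sw _ _ (sw_lin b1)); apply: eq_sw => x1 x2.
rewrite (lin_sw _ _ (sw_lin b1)); symmetry.
rewrite (@cop_sw k E _ (fun y1 y2 : E => (x2 * y1 : cop E) ⊗ (x1 * y2 : cop E))).
  by apply: eq_sw => y1 y2; rewrite sw_pure.
by apply: bilinI => ?; lin_tac.
Qed.

HB.instance Definition _ := isBialgebra.Build k (cop E)
  cop_comul1 cop_comulM (@counit1 k E) (@counitM k E).
End CopBialgebra.

Section HopfTheory.
Variables (k : fieldType) (H : hopfType k).
Notation S := (@antipode k H).

Lemma sw_antipodel (W : lmodType k) (f : H -> W) x : lin f ->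
  \sw_(a, b <- Δ x) f (S a * b) = (ε x : k) *: f 1.
Proof. by move=> lf; rewrite -(lin_sw _ _ lf) antipodel (linZ lf). Qed.

Lemma sw_antipoder (W : lmodType k) (f : H -> W) x : lin f ->
  \sw_(a, b <- Δ x) f (a * S b) = (ε x : k) *: f 1.
Proof. by move=> lf; rewrite -(lin_sw _ _ lf) antipoder (linZ lf). Qed.

Lemma antipode1 : S 1 = 1.
Proof.
have := @antipodel k H 1; rewrite comul1 sw_pure ?mulr1 ?counit1 ?scale1r //.
by apply: bilinI => ?; lin_tac.
Qed.

Lemma antipodeM x y : S (x * y) = S y * S x.
Proof.
transitivity (\sw_(x1, x' <- Δ x) \sw_(y1, y' <- Δ y)
  \sw_(x2, x3 <- Δ x') \sw_(y2, y3 <- Δ y')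
    S (x1 * y1) * (x2 * y2) * (S y3 * S x3)).
  transitivity (\sw_(x1, x' <- Δ x) \sw_(y1, y' <- Δ y)
      (ε x' : k) *: ((ε y' : k) *: S (x1 * y1))); last first.
    apply: eq_sw => x1 x'; apply: eq_sw => y1 y'.
    transitivity (\sw_(x2, x3 <- Δ x')
      (ε y' : k) *: (S (x1 * y1) * (x2 * S x3))).
      rewrite (@sw_antipoder _ (fun z => (ε y' : k) *: (S (x1 * y1) * z))).
        by rewrite mulr1.
      by lin_tac.
    apply: eq_sw => x2 x3.
    transitivity (\sw_(y2, y3 <- Δ y')
      (S (x1 * y1) * (x2 * ((y2 * S y3) * S x3)))).
      rewrite (@sw_antipoder _ (fun z => S (x1 * y1) * (x2 * (z * S x3)))).
        by rewrite mul1r.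
      by lin_tac.
    by apply: eq_sw => y2 y3; rewrite !mulrA.
  transitivity (\sw_(x1, x' <- Δ x) (ε x' : k) *: S (x1 * y)).
    by rewrite (@sw_counitr _ _ _ (fun z => S (z * y))) //; lin_tac.
  apply: eq_sw => x1 x'; rewrite swZ.
  by rewrite (@sw_counitr _ _ _ (fun z => S (x1 * z))) //; lin_tac.
transitivity (\sw_(x', x3 <- Δ x) \sw_(x1, x2 <- Δ x')
  \sw_(y', y3 <- Δ y) \sw_(y1, y2 <- Δ y')
    S (x1 * y1) * (x2 * y2) * (S y3 * S x3)).
  rewrite (@sw_comulA _ _ _ (fun x1 x2 x3 => \sw_(y', y3 <- Δ y)
    \sw_(y1, y2 <- Δ y') S (x1 * y1) * (x2 * y2) * (S y3 * S x3))); last first.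
    by split=> ? ?; lin_tac.
  apply: eq_sw => x1 x'; rewrite exch_sw; apply: eq_sw => x2 x3.
  rewrite (@sw_comulA _ _ _ (fun y1 y2 y3 =>
    S (x1 * y1) * (x2 * y2) * (S y3 * S x3))) //.
  by split=> ? ?; lin_tac.
transitivity (\sw_(x', x3 <- Δ x) \sw_(y', y3 <- Δ y)
   (ε x' : k) *: ((ε y' : k) *: (S y3 * S x3))).
  apply: eq_sw => x' x3; rewrite exch_sw; apply: eq_sw => y' y3.
  have := @antipodel k H (x' * y'); rewrite comulM counitM.
  pose G z := z * (S y3 * S x3).
  have lG : lin G by rewrite /G; lin_tac.
  move=> /(congr1 G); rewrite [in X in _ = X -> _]/G -scalerAl mul1r -scalerA => <-.
  have b1 : bilin (fun a b => S a * b) by apply: bilinI => ?; lin_tac.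
  rewrite (lin_sw _ _ (sw_lin b1)) (lin_sw _ _ lG); apply: eq_sw => x1 x2.
  rewrite (lin_sw _ _ (sw_lin b1)) (lin_sw _ _ lG); apply: eq_sw => y1 y2.
  by rewrite sw_pure.
transitivity (\sw_(x', x3 <- Δ x) (ε x' : k) *: (S y * S x3)).
  apply: eq_sw => x' x3; rewrite swZ.
  by rewrite (@sw_counitl _ _ _ (fun z => S z * S x3)) //; lin_tac.
by rewrite (@sw_counitl _ _ _ (fun z => S y * S z)) //; lin_tac.
Qed.

Lemma counit_antipode x : ε (S x) = ε x :> k.
Proof.
have lc := @lin_counit k H.
have := congr1 (@counit k H) (@antipodel k H x).
rewrite (lin_sw _ _ lc) (linZ lc) counit1 [_ *: _]mulr1 => <-.
rewrite -[in LHS](counitr x) (lin_sw _ _ (@lin_antipode k H)) (lin_sw _ _ lc).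
apply: eq_sw => a b; rewrite (linZ (@lin_antipode k H)) (linZ lc) counitM.
exact: mulrC.
Qed.

End HopfTheory.

Record weakDuality (k : fieldType) (C B : hopfType k) := WeakDuality {
  pairing :> C -> B -> k;
  pairing_bilin : biform pairing;
  pairingMl : forall c c' b,
    pairing (c * c') b = \sw_(b1, b2 <- Δ b) pairing c b2 * pairing c' b1;
  pairingMr : forall c b b',
    pairing c (b * b') = \sw_(c1, c2 <- Δ c) pairing c2 b * pairing c1 b';
  pairing1l : forall b, pairing 1 b = ε b;
  pairing1r : forall c, pairing c 1 = ε c;
  pairingS : forall c b, pairing (antipode c) b = pairing c (antipode b)
}.

Section DrinAlgebra.
Variables (k : fieldType) (C B : hopfType k) (ev : weakDuality C B).

(* Drin is the k-algebra presented by generators and relations: the expressions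
   dterm in elements of B and C modulo dcong, the least congruence that imposes
   the axioms of a unital k-algebra, makes dB and dC morphisms of unital
   k-algebras, and imposes dcong_exchange, that is
     b_(2) c_(1) ev(c_(2), b_(1)) = c_(2) b_(1) ev(c_(1), b_(2)).
   The zero and the unit are dB 0 and dB 1. *)
Inductive dterm : Type :=
| dB of B
| dC of C
| dadd of dterm & dterm
| dscale of k & dterm
| dmul of dterm & dterm.

HB.instance Definition _ := gen_eqMixin dterm.
HB.instance Definition _ := gen_choiceMixin dterm.

Definition dsum (s : seq dterm) : dterm := foldr dadd (dB 0) s.

Inductive dcong : dterm -> dterm -> Prop :=
| dcong_refl x : dcong x x
| dcong_sym x y : dcong x y -> dcong y x
| dcong_trans x y z : dcong x y -> dcong y z -> dcong x z
| dcong_add x x' y y' : dcong x x' -> dcong y y' -> dcong (dadd x y) (dadd x' y')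
| dcong_scale a x x' : dcong x x' -> dcong (dscale a x) (dscale a x')
| dcong_mul x x' y y' : dcong x x' -> dcong y y' -> dcong (dmul x y) (dmul x' y')
| dcong_addA x y z : dcong (dadd x (dadd y z)) (dadd (dadd x y) z)
| dcong_addC x y : dcong (dadd x y) (dadd y x)
| dcong_add0 x : dcong (dadd (dB 0) x) x
| dcong_addN x : dcong (dadd (dscale (-1) x) x) (dB 0)
| dcong_scaleA a b x : dcong (dscale a (dscale b x)) (dscale (a * b) x)
| dcong_scale1 x : dcong (dscale 1 x) x
| dcong_scaleDr a x y : dcong (dscale a (dadd x y)) (dadd (dscale a x) (dscale a y))
| dcong_scaleDl a b x : dcong (dscale (a + b) x) (dadd (dscale a x) (dscale b x))
| dcong_mulA x y z : dcong (dmul x (dmul y z)) (dmul (dmul x y) z)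
| dcong_mul1l x : dcong (dmul (dB 1) x) x
| dcong_mul1r x : dcong (dmul x (dB 1)) x
| dcong_mulDl x y z : dcong (dmul (dadd x y) z) (dadd (dmul x z) (dmul y z))
| dcong_mulDr x y z : dcong (dmul x (dadd y z)) (dadd (dmul x y) (dmul x z))
| dcong_scaleAl a x y : dcong (dscale a (dmul x y)) (dmul (dscale a x) y)
| dcong_scaleAr a x y : dcong (dscale a (dmul x y)) (dmul x (dscale a y))
| dcong_B_add b b' : dcong (dB (b + b')) (dadd (dB b) (dB b'))
| dcong_B_scale a b : dcong (dB (a *: b)) (dscale a (dB b))
| dcong_B_mul b b' : dcong (dB (b * b')) (dmul (dB b) (dB b'))
| dcong_C_add c c' : dcong (dC (c + c')) (dadd (dC c) (dC c'))
| dcong_C_scale a c : dcong (dC (a *: c)) (dscale a (dC c))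
| dcong_C_mul c c' : dcong (dC (c * c')) (dmul (dC c) (dC c'))
| dcong_C_1 : dcong (dC 1) (dB 1)
| dcong_exchange b c :
    dcong (dsum [seq dscale (ev q.2 p.1) (dmul (dB p.2) (dC q.1))
                | p <- repr (Δ b), q <- repr (Δ c)])
          (dsum [seq dscale (ev q.1 p.2) (dmul (dC q.2) (dB p.1))
                | p <- repr (Δ b), q <- repr (Δ c)]).

Definition dcongb (x y : dterm) : bool := `[< dcong x y >].

Lemma dcongb_equiv : equiv_class_of dcongb.
Proof.
split.
- by move=> s; apply/asboolP; exact: dcong_refl.
- by move=> s t; apply/asboolP/asboolP; exact: dcong_sym.
- move=> s t r /asboolP h1 /asboolP h2; apply/asboolP.
  exact: dcong_trans h1 h2.
Qed.

Canonical dcong_equivRel := EquivRelPack dcongb_equiv.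

Definition Drin := {eq_quot dcongb}.
HB.instance Definition _ := Choice.on Drin.
HB.instance Definition _ := EqQuotient.on Drin.

Lemma drinP x y : dcong x y -> \pi_Drin x = \pi_Drin y.
Proof. by move=> h; apply/eqmodP/asboolP. Qed.

Lemma drin_reprP x : dcong (repr (\pi_Drin x)) x.
Proof. by apply/asboolP; have /eqmodP := reprK (\pi_Drin x). Qed.

Definition drin_zero : Drin := \pi_Drin (dB 0).
Definition drin_one : Drin := \pi_Drin (dB 1).
Definition drin_add (x y : Drin) : Drin := \pi_Drin (dadd (repr x) (repr y)).
Definition drin_mul (x y : Drin) : Drin := \pi_Drin (dmul (repr x) (repr y)).
Definition drin_scale (a : k) (x : Drin) : Drin := \pi_Drin (dscale a (repr x)).
Definition drin_opp : Drin -> Drin := drin_scale (-1).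

Lemma drin_addE x y : drin_add (\pi_Drin x) (\pi_Drin y) = \pi_Drin (dadd x y).
Proof. by apply: drinP; apply: dcong_add; exact: drin_reprP. Qed.
Lemma drin_mulE x y : drin_mul (\pi_Drin x) (\pi_Drin y) = \pi_Drin (dmul x y).
Proof. by apply: drinP; apply: dcong_mul; exact: drin_reprP. Qed.
Lemma drin_scaleE a x : drin_scale a (\pi_Drin x) = \pi_Drin (dscale a x).
Proof. by apply: drinP; apply: dcong_scale; exact: drin_reprP. Qed.

Lemma drin_ind_pi (P : Drin -> Prop) : (forall s, P (\pi_Drin s)) -> forall x, P x.
Proof. by move=> h x; rewrite -[x]reprK. Qed.

Lemma drin_addA : associative drin_add.
Proof.
elim/drin_ind_pi=> x; elim/drin_ind_pi=> y; elim/drin_ind_pi=> z.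
by rewrite (drin_addE y z) (drin_addE x y) !drin_addE; apply/drinP/dcong_addA.
Qed.
Lemma drin_addC : commutative drin_add.
Proof.
elim/drin_ind_pi=> x; elim/drin_ind_pi=> y.
by rewrite !drin_addE; apply/drinP/dcong_addC.
Qed.
Lemma drin_add0 : left_id drin_zero drin_add.
Proof. by elim/drin_ind_pi=> x; rewrite drin_addE; apply/drinP/dcong_add0. Qed.
Lemma drin_addN : left_inverse drin_zero drin_opp drin_add.
Proof.
by elim/drin_ind_pi=> x; rewrite /drin_opp drin_scaleE drin_addE;
  apply/drinP/dcong_addN.
Qed.
HB.instance Definition _ :=
  GRing.isZmodule.Build Drin drin_addA drin_addC drin_add0 drin_addN.

Lemma drin_scaleA a b x : drin_scale a (drin_scale b x) = drin_scale (a * b) x.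
Proof.
elim/drin_ind_pi: x => x; rewrite (drin_scaleE b) !drin_scaleE.
exact/drinP/dcong_scaleA.
Qed.
Lemma drin_scale1 : left_id 1 drin_scale.
Proof. by elim/drin_ind_pi=> x; rewrite drin_scaleE; apply/drinP/dcong_scale1. Qed.
Lemma drin_scaleDr : right_distributive drin_scale +%R.
Proof.
move=> a; elim/drin_ind_pi=> x; elim/drin_ind_pi=> y.
rewrite [LHS](_ : _ = drin_scale a (drin_add (\pi_Drin x) (\pi_Drin y))) //.
rewrite [RHS](_ : _ =
  drin_add (drin_scale a (\pi_Drin x)) (drin_scale a (\pi_Drin y))) //.
by rewrite (drin_addE x y) !drin_scaleE drin_addE; apply/drinP/dcong_scaleDr.
Qed.
Lemma drin_scaleDl v : {morph drin_scale^~ v : a b / a + b}.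
Proof.
elim/drin_ind_pi: v => x a b /=.
rewrite [RHS](_ : _ =
  drin_add (drin_scale a (\pi_Drin x)) (drin_scale b (\pi_Drin x))) //.
by rewrite !drin_scaleE drin_addE; apply/drinP/dcong_scaleDl.
Qed.
HB.instance Definition _ := GRing.Zmodule_isLmodule.Build k Drin
  drin_scaleA drin_scale1 drin_scaleDr drin_scaleDl.

Lemma drin_mulA : associative drin_mul.
Proof.
elim/drin_ind_pi=> x; elim/drin_ind_pi=> y; elim/drin_ind_pi=> z.
by rewrite (drin_mulE y z) (drin_mulE x y) !drin_mulE; apply/drinP/dcong_mulA.
Qed.
Lemma drin_mul1 : left_id drin_one drin_mul.
Proof. by elim/drin_ind_pi=> x; rewrite drin_mulE; apply/drinP/dcong_mul1l. Qed.
Lemma drin_mulr1 : right_id drin_one drin_mul.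
Proof. by elim/drin_ind_pi=> x; rewrite drin_mulE; apply/drinP/dcong_mul1r. Qed.
Lemma drin_mulDl : left_distributive drin_mul +%R.
Proof.
elim/drin_ind_pi=> x; elim/drin_ind_pi=> y; elim/drin_ind_pi=> z.
rewrite [LHS](_ : _ = drin_mul (drin_add (\pi_Drin x) (\pi_Drin y)) (\pi_Drin z)) //.
rewrite [RHS](_ : _ = drin_add (drin_mul (\pi_Drin x) (\pi_Drin z))
  (drin_mul (\pi_Drin y) (\pi_Drin z))) //.
by rewrite (drin_addE x y) !drin_mulE drin_addE; apply/drinP/dcong_mulDl.
Qed.
Lemma drin_mulDr : right_distributive drin_mul +%R.
Proof.
elim/drin_ind_pi=> x; elim/drin_ind_pi=> y; elim/drin_ind_pi=> z.
rewrite [LHS](_ : _ = drin_mul (\pi_Drin x) (drin_add (\pi_Drin y) (\pi_Drin z))) //.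
rewrite [RHS](_ : _ = drin_add (drin_mul (\pi_Drin x) (\pi_Drin y))
  (drin_mul (\pi_Drin x) (\pi_Drin z))) //.
by rewrite (drin_addE y z) !drin_mulE drin_addE; apply/drinP/dcong_mulDr.
Qed.

Fixpoint dterm_counit (x : dterm) : k :=
  match x with
  | dB b => ε b
  | dC c => ε c
  | dadd x y => dterm_counit x + dterm_counit y
  | dscale a x => a * dterm_counit x
  | dmul x y => dterm_counit x * dterm_counit y
  end.

Lemma dsumE (W : nmodType) (f : dterm -> W) (r : seq dterm) :
  f (dB 0) = 0 -> (forall x y, f (dadd x y) = f x + f y) ->
  f (dsum r) = \sum_(x <- r) f x.
Proof.
move=> f0 fD; elim: r => [|x r ih]; first by rewrite big_nil.
by rewrite big_cons -ih -fD.
Qed.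

Lemma dsum_sw (W : nmodType) (f : dterm -> W) (b : B) (c : C) F :
  f (dB 0) = 0 -> (forall x y, f (dadd x y) = f x + f y) ->
  f (dsum [seq F p.1 p.2 q.1 q.2 | p <- repr (Δ b), q <- repr (Δ c)]) =
  \sw_(b1, b2 <- Δ b) \sw_(c1, c2 <- Δ c) f (F b1 b2 c1 c2).
Proof. by move=> f0 fD; rewrite dsumE // big_allpairs_dep. Qed.

Lemma dterm_counitP x y : dcong x y -> dterm_counit x = dterm_counit y.
Proof.
have e0 : dterm_counit (dB 0) = 0 by rewrite /= (lin0 (@lin_counit k B)).
have lB := @lin_counit k B; have lC := @lin_counit k C.
elim=> {x y} //=.
- by move=> x y z _ -> _ ->.
- by move=> x x' y y' _ -> _ ->.
- by move=> a x x' _ ->.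
- by move=> x x' y y' _ -> _ ->.
- by move=> x y z; rewrite addrA.
- by move=> x y; rewrite addrC.
- by move=> x; rewrite (lin0 lB) add0r.
- by move=> x; rewrite (lin0 lB) mulN1r addNr.
- by move=> a b x; rewrite mulrA.
- by move=> x; rewrite mul1r.
- by move=> a x y; rewrite mulrDr.
- by move=> a b x; rewrite mulrDl.
- by move=> x y z; rewrite mulrA.
- by move=> x; rewrite counit1 mul1r.
- by move=> x; rewrite counit1 mulr1.
- by move=> x y z; rewrite mulrDl.
- by move=> x y z; rewrite mulrDr.
- by move=> a x y; rewrite mulrA.
- by move=> a x y; rewrite mulrCA.
- by move=> b b'; exact: (linD lB).
- by move=> a b; exact: (linZ lB).
- by move=> b b'; rewrite counitM.
- by move=> b b'; exact: (linD lC).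
- by move=> a b; exact: (linZ lC).
- by move=> b b'; rewrite counitM.
- by rewrite !counit1.
move=> b c.
have bev := pairing_bilin ev.
rewrite (@dsum_sw _ _ b c (fun b1 b2 c1 c2 => dscale (ev c2 b1) (dmul (dB b2) (dC c1)))) //.
rewrite (@dsum_sw _ _ b c (fun b1 b2 c1 c2 => dscale (ev c1 b2) (dmul (dC c2) (dB b1)))) //=.
transitivity (ev c b).
  transitivity (\sw_(b1, b2 <- Δ b) (ε b2 *: (ev c b1 : k^o))).
    apply: eq_sw => b1 b2.
    transitivity (\sw_(c1, c2 <- Δ c) (ε c1 *: (ε b2 *: (ev c2 b1 : k^o)))).
      by apply: eq_sw => c1 c2; rewrite mulrC [ε b2 * _]mulrC -mulrA.
    by apply: (@sw_counitl k C k^o (fun z => ε b2 *: (ev z b1 : k^o))); lin_tac.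
  by apply: (@sw_counitr k B k^o (fun z => ev c z)); lin_tac.
symmetry; transitivity (\sw_(b1, b2 <- Δ b) (ε b1 *: (ev c b2 : k^o))).
  apply: eq_sw => b1 b2.
  transitivity (\sw_(c1, c2 <- Δ c) (ε c2 *: (ε b1 *: (ev c1 b2 : k^o)))).
    by apply: eq_sw => c1 c2; rewrite mulrC -mulrA.
  apply: (@sw_counitr k C k^o (fun z => ε b1 *: (ev z b2 : k^o))); lin_tac.
by apply: (@sw_counitl k B k^o (fun z => ev c z)); lin_tac.
Qed.

Definition drin_counit (x : Drin) : k := dterm_counit (repr x).

Lemma drin_counit_pi x : drin_counit (\pi_Drin x) = dterm_counit x.
Proof. by apply: dterm_counitP; exact: drin_reprP. Qed.

Lemma drin_one_neq0 : drin_one != 0 :> Drin.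
Proof.
apply/eqP => /(congr1 drin_counit); rewrite [0](_ : _ = \pi_Drin (dB 0)) //.
rewrite !drin_counit_pi /= counit1 (lin0 (@lin_counit k B)).
by apply/eqP; exact: oner_neq0.
Qed.

HB.instance Definition _ := GRing.Zmodule_isNzRing.Build Drin
  drin_mulA drin_mul1 drin_mulr1 drin_mulDl drin_mulDr drin_one_neq0.

Lemma drin_scaleAl a (x y : Drin) : a *: (x * y) = (a *: x) * y.
Proof.
elim/drin_ind_pi: x => x; elim/drin_ind_pi: y => y.
rewrite [LHS](_ : _ = drin_scale a (drin_mul (\pi_Drin x) (\pi_Drin y))) //.
rewrite [RHS](_ : _ = drin_mul (drin_scale a (\pi_Drin x)) (\pi_Drin y)) //.
rewrite (drin_mulE x y) !drin_scaleE drin_mulE; exact/drinP/dcong_scaleAl.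
Qed.
HB.instance Definition _ := GRing.Lmodule_isLalgebra.Build k Drin drin_scaleAl.

Lemma drin_scaleAr a (x y : Drin) : a *: (x * y) = x * (a *: y).
Proof.
elim/drin_ind_pi: x => x; elim/drin_ind_pi: y => y.
rewrite [LHS](_ : _ = drin_scale a (drin_mul (\pi_Drin x) (\pi_Drin y))) //.
rewrite [RHS](_ : _ = drin_mul (\pi_Drin x) (drin_scale a (\pi_Drin y))) //.
rewrite (drin_mulE x y) !drin_scaleE drin_mulE; exact/drinP/dcong_scaleAr.
Qed.
HB.instance Definition _ := GRing.Lalgebra_isAlgebra.Build k Drin drin_scaleAr.

Lemma drin_piD x y : \pi_Drin (dadd x y) = (\pi_Drin x : Drin) + (\pi_Drin y : Drin).
Proof. by rewrite -drin_addE. Qed.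
Lemma drin_piM x y : \pi_Drin (dmul x y) = (\pi_Drin x : Drin) * (\pi_Drin y : Drin).
Proof. by rewrite -drin_mulE. Qed.
Lemma drin_piZ a x : \pi_Drin (dscale a x) = a *: (\pi_Drin x : Drin).
Proof. by rewrite -drin_scaleE. Qed.

Definition drinB (b : B) : Drin := \pi_Drin (dB b).
Definition drinC (c : C) : Drin := \pi_Drin (dC c).

Lemma lin_drinB : lin drinB.
Proof.
move=> a b b'; rewrite /drinB -drin_piZ -drin_piD; apply: drinP.
apply: dcong_trans (dcong_B_add _ _) _; apply: dcong_add (dcong_refl _).
exact: dcong_B_scale.
Qed.
Lemma lin_drinC : lin drinC.
Proof.
move=> a b b'; rewrite /drinC -drin_piZ -drin_piD; apply: drinP.
apply: dcong_trans (dcong_C_add _ _) _; apply: dcong_add (dcong_refl _).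
exact: dcong_C_scale.
Qed.
Lemma drinBM b b' : drinB (b * b') = drinB b * drinB b'.
Proof. by rewrite -drin_piM; apply/drinP/dcong_B_mul. Qed.
Lemma drinCM c c' : drinC (c * c') = drinC c * drinC c'.
Proof. by rewrite -drin_piM; apply/drinP/dcong_C_mul. Qed.
Lemma drinB1 : drinB 1 = 1. Proof. by []. Qed.
Lemma drinC1 : drinC 1 = 1. Proof. exact/drinP/dcong_C_1. Qed.

Lemma drin_exchange b c :
  \sw_(b1, b2 <- Δ b) \sw_(c1, c2 <- Δ c) ev c2 b1 *: (drinB b2 * drinC c1) =
  \sw_(b1, b2 <- Δ b) \sw_(c1, c2 <- Δ c) ev c1 b2 *: (drinC c2 * drinB b1).
Proof.
have := drinP (dcong_exchange b c).
have fD := drin_piD.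
rewrite (@dsum_sw Drin (\pi_Drin) b c (fun b1 b2 c1 c2 => dscale (ev c2 b1) (dmul (dB b2) (dC c1)))) //.
rewrite (@dsum_sw Drin (\pi_Drin) b c (fun b1 b2 c1 c2 => dscale (ev c1 b2) (dmul (dC c2) (dB b1)))) //.
move=> h; etransitivity; last (etransitivity; first exact: h).
  by apply: eq_sw => b1 b2; apply: eq_sw => c1 c2; rewrite drin_piZ drin_piM.
by apply: eq_sw => b1 b2; apply: eq_sw => c1 c2; rewrite drin_piZ drin_piM.
Qed.

Lemma drin_ind (P : Drin -> Prop) :
  (forall b, P (drinB b)) -> (forall c, P (drinC c)) ->
  (forall x y, P x -> P y -> P (x + y)) -> (forall a x, P x -> P (a *: x)) ->
  (forall x y, P x -> P y -> P (x * y)) -> forall x, P x.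
Proof.
move=> hB hC hD hZ hM; elim/drin_ind_pi; elim=> [b|c|x hx y hy|a x hx|x hx y hy].
- exact: hB.
- exact: hC.
- by rewrite drin_piD; apply: hD.
- by rewrite drin_piZ; apply: hZ.
- by rewrite drin_piM; apply: hM.
Qed.

End DrinAlgebra.

Section TensorMul.
Variables (k : fieldType) (A A' : algType k).

Definition tmul (s t : tens A A') : tens A A' :=
  \sw_(x1, x2 <- s) \sw_(y1, y2 <- t) (x1 * y1) ⊗ (x2 * y2).

Lemma tmul_bilin : bilin tmul.
Proof.
apply: bilinI; rewrite /tmul => s; last by lin_tac.
apply: (@lin_swt _ _ _ _ _ _ (fun x => x)); last by lin_tac.
by apply: bilinI => ?; lin_tac.
Qed.

Lemma tmul_sw (W : lmodType k) (f : A -> A' -> W) s t : bilin f ->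
  sweedler f (tmul s t) =
  \sw_(x1, x2 <- s) \sw_(y1, y2 <- t) f (x1 * y1) (x2 * y2).
Proof.
move=> bf; rewrite /tmul (lin_sw _ _ (sw_lin bf)); apply: eq_sw => x1 x2.
rewrite (lin_sw _ _ (sw_lin bf)); apply: eq_sw => y1 y2.
by rewrite sw_pure.
Qed.

Lemma tmul_pure x1 x2 y1 y2 :
  tmul (x1 ⊗ x2) (y1 ⊗ y2) = (x1 * y1) ⊗ (x2 * y2).
Proof.
rewrite /tmul sw_pure; last by apply: bilinI => ?; lin_tac.
by rewrite sw_pure //; apply: bilinI => ?; lin_tac.
Qed.

Lemma tmulA s t r : tmul s (tmul t r) = tmul (tmul s t) r.
Proof.
have [bl br] := tmul_bilin.
move: s; apply: tens_eqP.
- by move=> a x y; rewrite bl.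
- by move=> a x y; rewrite bl bl.
move=> x1 x2; move: t; apply: tens_eqP.
- by move=> a x y; rewrite bl br.
- by move=> a x y; rewrite br bl.
move=> y1 y2; move: r; apply: tens_eqP.
- by move=> a x y; rewrite br br.
- by move=> a x y; rewrite br.
by move=> z1 z2; rewrite !tmul_pure !mulrA.
Qed.

Lemma tmul1l s : tmul (1 ⊗ 1) s = s.
Proof.
have [bl br] := tmul_bilin.
move: s; apply: tens_eqP => //; first exact: br.
by move=> u v; rewrite tmul_pure !mul1r.
Qed.

Lemma tmul1r s : tmul s (1 ⊗ 1) = s.
Proof.
have [bl br] := tmul_bilin.
move: s; apply: tens_eqP => //; first exact: bl.
by move=> u v; rewrite tmul_pure !mulr1.
Qed.

End TensorMul.

Section DrinBialgebra.
Variables (k : fieldType) (C B : hopfType k) (ev : weakDuality C B).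
Notation D := (Drin ev).
Notation iB := (drinB ev).
Notation iC := (drinC ev).

(* The coproduct of Drin extends that of B and the opposite of that of C. *)
Definition comulB (b : B) : tens D D := \sw_(b1, b2 <- Δ b) iB b1 ⊗ iB b2.
Definition comulC (c : C) : tens D D := \sw_(c1, c2 <- Δ c) iC c2 ⊗ iC c1.

Fixpoint dterm_comul (x : dterm C B) : tens D D :=
  match x with
  | dB b => comulB b
  | dC c => comulC c
  | dadd x y => dterm_comul x + dterm_comul y
  | dscale a x => a *: dterm_comul x
  | dmul x y => tmul (dterm_comul x) (dterm_comul y)
  end.

Lemma lin_iB (U : lmodType k) (f : U -> B) : lin f -> lin (fun x : U => iB (f x)).
Proof. exact: lin_cmp (@lin_drinB k C B ev). Qed.
Lemma lin_iC (U : lmodType k) (f : U -> C) : lin f -> lin (fun x : U => iC (f x)).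
Proof. exact: lin_cmp (@lin_drinC k C B ev). Qed.

End DrinBialgebra.

Ltac lin_tac2 := repeat (cbv beta; first
  [ progress lin_step
  | apply: lin_iB | apply: lin_iC
  | match goal with |- lin (fun x => pairing ?e (@?g x) ?a) =>
      refine (@lin_bfl _ _ _ _ (pairing e) g a (pairing_bilin e) _) end
  | match goal with |- lin (fun x => pairing ?e ?a (@?g x)) =>
      refine (@lin_bfr _ _ _ _ (pairing e) g a (pairing_bilin e) _) end ]).

Section DrinBialgebra2.
Variables (k : fieldType) (C B : hopfType k) (ev : weakDuality C B).
Notation D := (Drin ev).
Notation iB := (drinB ev).
Notation iC := (drinC ev).

Lemma lin_comulB : lin (comulB ev).
Proof. by rewrite /comulB; lin_tac2. Qed.
Lemma lin_comulC : lin (comulC ev).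
Proof. by rewrite /comulC; lin_tac2. Qed.

Lemma comulB1 : comulB ev 1 = 1 ⊗ 1.
Proof.
rewrite /comulB comul1 sw_pure //.
by apply: bilinI => ?; lin_tac2.
Qed.
Lemma comulC1 : comulC ev 1 = 1 ⊗ 1.
Proof.
rewrite /comulC comul1 sw_pure ?drinC1 //.
by apply: bilinI => ?; lin_tac2.
Qed.
Lemma comulBM b b' : comulB ev (b * b') = tmul (comulB ev b) (comulB ev b').
Proof.
have [bl br] := @tmul_bilin k D D.
rewrite /comulB comulM (lin_sw _ _ (bl _)).
have bt : bilin (fun b1 b2 => iB b1 ⊗ iB b2) by apply: bilinI => ?; lin_tac2.
rewrite (lin_sw _ _ (sw_lin bt)); apply: eq_sw => b1 b2.
rewrite (lin_sw _ _ (sw_lin bt)) (lin_sw _ _ (br _)); apply: eq_sw => b1' b2'.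
by rewrite sw_pure // tmul_pure !drinBM.
Qed.
Lemma comulCM b b' : comulC ev (b * b') = tmul (comulC ev b) (comulC ev b').
Proof.
have [bl br] := @tmul_bilin k D D.
rewrite /comulC comulM (lin_sw _ _ (bl _)).
have bt : bilin (fun b1 b2 => iC b2 ⊗ iC b1) by apply: bilinI => ?; lin_tac2.
rewrite (lin_sw _ _ (sw_lin bt)); apply: eq_sw => b1 b2.
rewrite (lin_sw _ _ (sw_lin bt)) (lin_sw _ _ (br _)); apply: eq_sw => b1' b2'.
by rewrite sw_pure // tmul_pure !drinCM.
Qed.

Lemma comul_exchange b c :
  \sw_(b1, b2 <- Δ b) \sw_(c1, c2 <- Δ c)
     ev c2 b1 *: tmul (comulB ev b2) (comulC ev c1) =
  \sw_(b1, b2 <- Δ b) \sw_(c1, c2 <- Δ c)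
     ev c1 b2 *: tmul (comulC ev c2) (comulB ev b1).
Proof.
have BC b' c' : tmul (comulB ev b') (comulC ev c') =
    \sw_(b1, b2 <- Δ b') \sw_(c1, c2 <- Δ c') (iB b1 * iC c2) ⊗ (iB b2 * iC c1).
  have [bl br] := @tmul_bilin k D D.
  rewrite /comulB /comulC (lin_sw _ _ (bl _)); apply: eq_sw => b1 b2.
  by rewrite (lin_sw _ _ (br _)); apply: eq_sw => c1 c2; rewrite tmul_pure.
have CB b' c' : tmul (comulC ev c') (comulB ev b') =
    \sw_(b1, b2 <- Δ b') \sw_(c1, c2 <- Δ c') (iC c2 * iB b1) ⊗ (iC c1 * iB b2).
  have [bl br] := @tmul_bilin k D D.
  rewrite exch_sw /comulB /comulC (lin_sw _ _ (bl _)); apply: eq_sw => c1 c2.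
  by rewrite (lin_sw _ _ (br _)); apply: eq_sw => b1 b2; rewrite tmul_pure.
have exch (L : D -> tens D D) b' c' : lin L ->
    \sw_(b1, b2 <- Δ b') \sw_(c1, c2 <- Δ c') L (ev c2 b1 *: (iB b2 * iC c1)) =
    \sw_(b1, b2 <- Δ b') \sw_(c1, c2 <- Δ c') L (ev c1 b2 *: (iC c2 * iB b1)).
  move=> lL; have := congr1 L (drin_exchange ev b' c').
  rewrite !(lin_sw _ _ lL).
  under eq_sw => b1 b2 do rewrite (lin_sw _ _ lL).
  by under [in RHS]eq_sw => b1 b2 do rewrite (lin_sw _ _ lL).
have tl := bilinl (@tpure_bilin k D D); have tr := bilinr (@tpure_bilin k D D).
transitivity (\sw_(b1, b' <- Δ b) \sw_(b2, b3 <- Δ b')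
    \sw_(c', c3 <- Δ c) \sw_(c1, c2 <- Δ c')
      (ev c3 b1 *: (iB b2 * iC c2)) ⊗ (iB b3 * iC c1)).
  apply: eq_sw => b1 b'; rewrite exch_sw; apply: eq_sw => c' c3.
  rewrite BC -swZ; apply: eq_sw => b2 b3.
  rewrite -swZ; apply: eq_sw => c1 c2.
  by rewrite (linZ (tl _)).
transitivity (\sw_(b', b3 <- Δ b) \sw_(b1, b2 <- Δ b')
    \sw_(c1, c' <- Δ c) \sw_(c2, c3 <- Δ c')
      (ev c3 b1 *: (iB b2 * iC c2)) ⊗ (iB b3 * iC c1)).
  rewrite -(@sw_comulA _ _ _ (fun b1 b2 b3 => \sw_(c', c3 <- Δ c)
    \sw_(c1, c2 <- Δ c') (ev c3 b1 *: (iB b2 * iC c2)) ⊗ (iB b3 * iC c1))).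
    apply: eq_sw => b' b3; apply: eq_sw => b1 b2.
    apply: (@sw_comulA _ _ _ (fun c1 c2 c3 =>
       (ev c3 b1 *: (iB b2 * iC c2)) ⊗ (iB b3 * iC c1))).
    by split=> ? ?; lin_tac2.
  by split=> ? ?; lin_tac2.
transitivity (\sw_(b', b3 <- Δ b) \sw_(c1, c' <- Δ c)
    \sw_(b1, b2 <- Δ b') \sw_(c2, c3 <- Δ c')
      (ev c2 b2 *: (iC c3 * iB b1)) ⊗ (iB b3 * iC c1)).
  apply: eq_sw => b' b3; rewrite exch_sw; apply: eq_sw => c1 c'.
  by apply: (exch (fun z => z ⊗ (iB b3 * iC c1))); apply: tl.
transitivity (\sw_(b1, b' <- Δ b) \sw_(c', c3 <- Δ c)
    \sw_(b2, b3 <- Δ b') \sw_(c1, c2 <- Δ c')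
      (iC c3 * iB b1) ⊗ (ev c2 b2 *: (iB b3 * iC c1))).
  transitivity (\sw_(b1, b' <- Δ b) \sw_(b2, b3 <- Δ b')
    \sw_(c1, c' <- Δ c) \sw_(c2, c3 <- Δ c')
      (ev c2 b2 *: (iC c3 * iB b1)) ⊗ (iB b3 * iC c1)).
    rewrite -(@sw_comulA _ _ _ (fun b1 b2 b3 => \sw_(c1, c' <- Δ c)
      \sw_(c2, c3 <- Δ c') (ev c2 b2 *: (iC c3 * iB b1)) ⊗ (iB b3 * iC c1))).
      by apply: eq_sw => b' b3; rewrite exch_sw.
    by split=> ? ?; lin_tac2.
  apply: eq_sw => b1 b'; rewrite [RHS]exch_sw; apply: eq_sw => b2 b3.
  rewrite -(@sw_comulA _ _ _ (fun c1 c2 c3 =>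
       (ev c2 b2 *: (iC c3 * iB b1)) ⊗ (iB b3 * iC c1))).
    apply: eq_sw => c' c3; apply: eq_sw => c1 c2.
    by rewrite (linZ (tl _)) (linZ (tr _)).
  by split=> ? ?; lin_tac2.
transitivity (\sw_(b1, b' <- Δ b) \sw_(c', c3 <- Δ c)
    \sw_(b2, b3 <- Δ b') \sw_(c1, c2 <- Δ c')
      (iC c3 * iB b1) ⊗ (ev c1 b3 *: (iC c2 * iB b2))).
  apply: eq_sw => b1 b'; apply: eq_sw => c' c3.
  by apply: (exch (fun z => (iC c3 * iB b1) ⊗ z)); apply: tr.
transitivity (\sw_(b', b3 <- Δ b) \sw_(b1, b2 <- Δ b') \sw_(c1, c' <- Δ c)
    \sw_(c2, c3 <- Δ c') (iC c3 * iB b1) ⊗ (ev c1 b3 *: (iC c2 * iB b2))).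
  rewrite (@sw_comulA _ _ _ (fun b1 b2 b3 => \sw_(c1, c' <- Δ c)
    \sw_(c2, c3 <- Δ c') (iC c3 * iB b1) ⊗ (ev c1 b3 *: (iC c2 * iB b2)))).
    apply: eq_sw => b1 b'; rewrite exch_sw; apply: eq_sw => b2 b3.
    apply: (@sw_comulA _ _ _ (fun c1 c2 c3 =>
      (iC c3 * iB b1) ⊗ (ev c1 b3 *: (iC c2 * iB b2)))).
    by split=> ? ?; lin_tac2.
  by split=> ? ?; lin_tac2.
apply: eq_sw => b' b3; rewrite exch_sw; apply: eq_sw => c1 c'.
rewrite CB -swZ; apply: eq_sw => b1 b2.
rewrite -swZ; apply: eq_sw => c2 c3.
by rewrite (linZ (tr _)).
Qed.

Lemma dterm_comulP x y : dcong ev x y -> dterm_comul ev x = dterm_comul ev y.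
Proof.
have [bl br] := @tmul_bilin k D D.
have lB := lin_comulB; have lC := lin_comulC.
elim=> {x y} //=.
- by move=> x y z _ -> _ ->.
- by move=> x x' y y' _ -> _ ->.
- by move=> a x x' _ ->.
- by move=> x x' y y' _ -> _ ->.
- by move=> x y z; rewrite addrA.
- by move=> x y; rewrite addrC.
- by move=> x; rewrite (lin0 lB) add0r.
- by move=> x; rewrite (lin0 lB) scaleN1r addNr.
- by move=> a b x; rewrite scalerA.
- by move=> x; rewrite scale1r.
- by move=> a x y; rewrite scalerDr.
- by move=> a b x; rewrite scalerDl.
- by move=> x y z; rewrite tmulA.
- by move=> x; rewrite comulB1 tmul1l.
- by move=> x; rewrite comulB1 tmul1r.
- by move=> x y z; rewrite (linD (bl _)).
- by move=> x y z; rewrite (linD (br _)).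
- by move=> a x y; rewrite (linZ (bl _)).
- by move=> a x y; rewrite (linZ (br _)).
- by move=> b b'; exact: (linD lB).
- by move=> a b; exact: (linZ lB).
- by move=> b b'; exact: comulBM.
- by move=> b b'; exact: (linD lC).
- by move=> a b; exact: (linZ lC).
- by move=> b b'; exact: comulCM.
- by rewrite comulB1 comulC1.
move=> b c.
rewrite (@dsum_sw _ _ _ _ (dterm_comul ev) b c
  (fun b1 b2 c1 c2 => dscale (ev c2 b1) (dmul (dB _ b2) (dC _ c1)))) //=; last exact: lin0.
rewrite (@dsum_sw _ _ _ _ (dterm_comul ev) b c
  (fun b1 b2 c1 c2 => dscale (ev c1 b2) (dmul (dC _ c2) (dB _ b1)))) //=; last exact: lin0.
exact: comul_exchange.
Qed.

Definition drin_comul (x : D) : tens D D := dterm_comul ev (repr x).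

Lemma drin_comul_pi x : drin_comul (\pi_D x) = dterm_comul ev x.
Proof. by apply: dterm_comulP; exact: drin_reprP. Qed.

Lemma drin_comulD x y : drin_comul (x + y) = drin_comul x + drin_comul y.
Proof.
elim/drin_ind_pi: x => x; elim/drin_ind_pi: y => y.
by rewrite -drin_piD !drin_comul_pi.
Qed.
Lemma drin_comulZ a x : drin_comul (a *: x) = a *: drin_comul x.
Proof.
by elim/drin_ind_pi: x => x; rewrite -drin_piZ !drin_comul_pi.
Qed.
Lemma drin_comul_linear : linear drin_comul.
Proof. by move=> a x y; rewrite drin_comulD drin_comulZ. Qed.
Lemma drin_comulM x y : drin_comul (x * y) = tmul (drin_comul x) (drin_comul y).
Proof.
elim/drin_ind_pi: x => x; elim/drin_ind_pi: y => y.
by rewrite -drin_piM !drin_comul_pi.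
Qed.
Lemma drin_comul_B b : drin_comul (iB b) = comulB ev b.
Proof. exact: drin_comul_pi. Qed.
Lemma drin_comul_C c : drin_comul (iC c) = comulC ev c.
Proof. exact: drin_comul_pi. Qed.
Lemma drin_comul1 : drin_comul 1 = 1 ⊗ 1.
Proof. by rewrite -(drinB1 ev) drin_comul_B comulB1. Qed.

Lemma drin_counit_B b : drin_counit (iB b) = ε b.
Proof. exact: drin_counit_pi. Qed.
Lemma drin_counit_C c : drin_counit (iC c) = ε c.
Proof. exact: drin_counit_pi. Qed.
Lemma drin_counitM (x y : D) : drin_counit (x * y) = drin_counit x * drin_counit y.
Proof.
elim/drin_ind_pi: x => x; elim/drin_ind_pi: y => y.
by rewrite -drin_piM !drin_counit_pi.
Qed.
Lemma drin_counit1 : drin_counit (1 : D) = 1.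
Proof. by rewrite -(drinB1 ev) drin_counit_B counit1. Qed.
Lemma drin_counit_linear : scalar (@drin_counit _ _ _ ev).
Proof.
move=> a x y; elim/drin_ind_pi: x => x; elim/drin_ind_pi: y => y.
by rewrite -drin_piZ -drin_piD !drin_counit_pi.
Qed.

Lemma drin_comulA x : coassoc_at drin_comul x.
Proof.
have lD : lin drin_comul by exact: drin_comul_linear.
pose L (t : tens D D) : tens D (tens D D) :=
  \sw_(a, b <- t) \sw_(a1, a2 <- drin_comul a) a1 ⊗ (a2 ⊗ b).
pose R (t : tens D D) : tens D (tens D D) :=
  \sw_(a, b <- t) \sw_(b1, b2 <- drin_comul b) a ⊗ (b1 ⊗ b2).
have bL : bilin (fun a b : D => \sw_(a1, a2 <- drin_comul a) a1 ⊗ (a2 ⊗ b)).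
  by apply: bilinI => ?; lin_tac2.
have bR : bilin (fun a b : D => \sw_(b1, b2 <- drin_comul b) a ⊗ (b1 ⊗ b2)).
  by apply: bilinI => ?; lin_tac2.
have lL := sw_lin bL; have lR := sw_lin bR.
move: x; apply: drin_ind.
- move=> b; rewrite /coassoc_at drin_comul_B /comulB.
  rewrite (lin_sw _ _ lL) (lin_sw _ _ lR).
  transitivity (\sw_(b1, b' <- Δ b) \sw_(b2, b3 <- Δ b1) iB b2 ⊗ (iB b3 ⊗ iB b')).
    apply: eq_sw => b1 b2; rewrite sw_pure // drin_comul_B /comulB.
    rewrite (lin_sw _ _ (sw_lin _)); last by apply: bilinI => ?; lin_tac2.
    by apply: eq_sw => b3 b4; rewrite sw_pure //; apply: bilinI => ?; lin_tac2.
  rewrite (@sw_comulA _ _ _ (fun b1 b2 b3 => iB b1 ⊗ (iB b2 ⊗ iB b3))); last first.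
    by split=> ? ?; lin_tac2.
  apply: eq_sw => b1 b2; rewrite sw_pure // drin_comul_B /comulB.
  rewrite (lin_sw _ _ (sw_lin _)); last by apply: bilinI => ?; lin_tac2.
  by apply: eq_sw => b3 b4; rewrite sw_pure //; apply: bilinI => ?; lin_tac2.
- move=> b; rewrite /coassoc_at drin_comul_C /comulC.
  rewrite (lin_sw _ _ lL) (lin_sw _ _ lR).
  transitivity (\sw_(b1, b' <- Δ b) \sw_(b2, b3 <- Δ b') iC b3 ⊗ (iC b2 ⊗ iC b1)).
    apply: eq_sw => b1 b2; rewrite sw_pure // drin_comul_C /comulC.
    rewrite (lin_sw _ _ (sw_lin _)); last by apply: bilinI => ?; lin_tac2.
    by apply: eq_sw => b3 b4; rewrite sw_pure //; apply: bilinI => ?; lin_tac2.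
  rewrite -(@sw_comulA _ _ _ (fun b1 b2 b3 => iC b3 ⊗ (iC b2 ⊗ iC b1))); last first.
    by split=> ? ?; lin_tac2.
  apply: eq_sw => b1 b2; rewrite sw_pure // drin_comul_C /comulC.
  rewrite (lin_sw _ _ (sw_lin _)); last by apply: bilinI => ?; lin_tac2.
  by apply: eq_sw => b3 b4; rewrite sw_pure //; apply: bilinI => ?; lin_tac2.
- by move=> x y hx hy; rewrite /coassoc_at drin_comulD (linD lL) (linD lR) hx hy.
- by move=> a x hx; rewrite /coassoc_at drin_comulZ (linZ lL) (linZ lR) hx.
move=> x y hx hy; rewrite /coassoc_at drin_comulM !tmul_sw //.
transitivity (\sw_(x', x3 <- drin_comul x) \sw_(x1, x2 <- drin_comul x')
  \sw_(y', y3 <- drin_comul y) \sw_(y1, y2 <- drin_comul y')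
  (x1 * y1) ⊗ ((x2 * y2) ⊗ (x3 * y3))).
  apply: eq_sw => x' x3; rewrite exch_sw; apply: eq_sw => y' y3.
  by rewrite drin_comulM tmul_sw //; apply: bilinI => ?; lin_tac2.
rewrite (@coassoc_trilin _ _ _ _ (fun x1 x2 x3 =>
  \sw_(y', y3 <- drin_comul y) \sw_(y1, y2 <- drin_comul y')
  (x1 * y1) ⊗ ((x2 * y2) ⊗ (x3 * y3)))) //; last first.
  by split=> ? ?; lin_tac2.
transitivity (\sw_(x1, x' <- drin_comul x) \sw_(x2, x3 <- drin_comul x')
  \sw_(y1, y' <- drin_comul y) \sw_(y2, y3 <- drin_comul y')
  (x1 * y1) ⊗ ((x2 * y2) ⊗ (x3 * y3))).
  apply: eq_sw => x1 x'; apply: eq_sw => x2 x3.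
  apply: (@coassoc_trilin _ _ _ _ (fun y1 y2 y3 =>
    (x1 * y1) ⊗ ((x2 * y2) ⊗ (x3 * y3)))) => //.
  by split=> ? ?; lin_tac2.
apply: eq_sw => x1 x'; rewrite exch_sw; apply: eq_sw => y1 y'.
by rewrite drin_comulM tmul_sw //; apply: bilinI => ?; lin_tac2.
Qed.

Lemma drin_counitl x : \sw_(a, b <- drin_comul x) drin_counit a *: b = x.
Proof.
have le : @lin k D k^o (@drin_counit _ _ _ ev) by exact: drin_counit_linear.
have be : bilin (fun a b : D => drin_counit a *: b).
  by apply: bilinI => u; [apply: lin_zl | lin_tac].
have ls := sw_lin be.
move: x; apply: drin_ind.
- move=> b; rewrite drin_comul_B /comulB (lin_sw _ _ ls).
  rewrite -[RHS](@sw_counitl _ _ _ iB); last by lin_tac2.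
  by apply: eq_sw => b1 b2; rewrite sw_pure // drin_counit_B.
- move=> b; rewrite drin_comul_C /comulC (lin_sw _ _ ls).
  rewrite -[RHS](@sw_counitr _ _ _ iC); last by lin_tac2.
  by apply: eq_sw => b1 b2; rewrite sw_pure // drin_counit_C.
- by move=> x y hx hy; rewrite drin_comulD (linD ls) hx hy.
- by move=> a x hx; rewrite drin_comulZ (linZ ls) hx.
move=> x y hx hy; rewrite drin_comulM tmul_sw //.
rewrite -{2}hx -{2}hy /sweedler mulr_suml; apply: eq_bigr => p _.
rewrite mulr_sumr; apply: eq_bigr => q _.
by rewrite drin_counitM -scalerA scalerAr scalerAl.
Qed.

Lemma drin_counitr x : \sw_(a, b <- drin_comul x) drin_counit b *: a = x.
Proof.
have le : @lin k D k^o (@drin_counit _ _ _ ev) by exact: drin_counit_linear.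
have be : bilin (fun a b : D => drin_counit b *: a).
  by apply: bilinI => u; [lin_tac | apply: lin_zl].
have ls := sw_lin be.
move: x; apply: drin_ind.
- move=> b; rewrite drin_comul_B /comulB (lin_sw _ _ ls).
  rewrite -[RHS](@sw_counitr _ _ _ iB); last by lin_tac2.
  by apply: eq_sw => b1 b2; rewrite sw_pure // drin_counit_B.
- move=> b; rewrite drin_comul_C /comulC (lin_sw _ _ ls).
  rewrite -[RHS](@sw_counitl _ _ _ iC); last by lin_tac2.
  by apply: eq_sw => b1 b2; rewrite sw_pure // drin_counit_C.
- by move=> x y hx hy; rewrite drin_comulD (linD ls) hx hy.
- by move=> a x hx; rewrite drin_comulZ (linZ ls) hx.
move=> x y hx hy; rewrite drin_comulM tmul_sw //.
rewrite -{2}hx -{2}hy /sweedler mulr_suml; apply: eq_bigr => p _.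
rewrite mulr_sumr; apply: eq_bigr => q _.
by rewrite drin_counitM -scalerA scalerAr scalerAl.
Qed.

HB.instance Definition _ := Lmodule_isCoalgebra.Build k D
  drin_comul_linear drin_counit_linear drin_comulA drin_counitl drin_counitr.
HB.instance Definition _ := isBialgebra.Build k D
  drin_comul1 drin_comulM drin_counit1 drin_counitM.

End DrinBialgebra2.

Section Action.
Variables (k : fieldType) (C B : hopfType k) (ev : weakDuality C B).
Notation S := antipode.

Lemma comulM_sw (E : bialgType k) (W : lmodType k) (f : E -> E -> W) x y :
  bilin f -> sweedler f (Δ (x * y)) =
  \sw_(x1, x2 <- Δ x) \sw_(y1, y2 <- Δ y) f (x1 * y1) (x2 * y2).
Proof. by move=> bf; rewrite comulM -/(tmul _ _) tmul_sw. Qed.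

Lemma pairingMl_sw (W : lmodType k) c d b (w : W) : ev (c * d) b *: w =
  \sw_(b1, b2 <- Δ b) ev d b1 *: (ev c b2 *: w).
Proof.
rewrite pairingMl /sweedler scaler_suml; apply: eq_bigr => p _.
by rewrite scalerA mulrC.
Qed.

Lemma pairingMr_sw (W : lmodType k) c b d (w : W) : ev c (b * d) *: w =
  \sw_(c1, c2 <- Δ c) ev c1 d *: (ev c2 b *: w).
Proof.
rewrite pairingMr /sweedler scaler_suml; apply: eq_bigr => p _.
by rewrite scalerA mulrC.
Qed.

(* The relations of Drin give c b = b_(2) c_(2) ev(c_(3), b_(1))
   ev(S c_(1), b_(3)); actl and actr are the two scalar factors, and actC is left
   multiplication by c on B ⊗ C (see drin_straighten). *)
Definition actl (c : C) (x : B) : B := \sw_(x1, x2 <- Δ x) ev c x1 *: x2.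
Definition actr (c : C) (x : B) : B := \sw_(x1, x2 <- Δ x) ev (S c) x2 *: x1.

Lemma actl_bilin : bilin actl.
Proof. by apply: bilinI => ?; rewrite /actl; lin_tac2. Qed.
Lemma actr_bilin : bilin actr.
Proof. by apply: bilinI => ?; rewrite /actr; lin_tac2. Qed.

Lemma actl1 x : actl 1 x = x.
Proof.
rewrite -[RHS](counitl x); apply: eq_sw => x1 x2.
by rewrite pairing1l.
Qed.
Lemma actr1 x : actr 1 x = x.
Proof.
rewrite -[RHS](counitr x); apply: eq_sw => x1 x2.
by rewrite antipode1 pairing1l.
Qed.

Lemma actlM c d x : actl (c * d) x = actl c (actl d x).
Proof.
have [_ br] := actl_bilin.
rewrite {3}/actl (lin_sw _ _ (br _)).
transitivity (\sw_(x', x3 <- Δ x) \sw_(x1, x2 <- Δ x') ev d x1 *: (ev c x2 *: x3)).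
  by apply: eq_sw => x' x3; rewrite pairingMl_sw.
rewrite (@sw_comulA _ _ _ (fun x1 x2 x3 => ev d x1 *: (ev c x2 *: x3))).
  by apply: eq_sw => x1 x'; rewrite swZ (linZ (br _)).
by split=> ? ?; lin_tac2.
Qed.

Lemma actrM c d x : actr (c * d) x = actr c (actr d x).
Proof.
have [_ br] := actr_bilin.
rewrite {3}/actr (lin_sw _ _ (br _)).
transitivity (\sw_(x1, x' <- Δ x) \sw_(x2, x3 <- Δ x')
  ev (S d) x3 *: (ev (S c) x2 *: x1)).
  apply: eq_sw => x1 x'; rewrite antipodeM pairingMl_sw.
  by apply: eq_sw => x2 x3; rewrite !scalerA mulrC.
rewrite -(@sw_comulA _ _ _ (fun x1 x2 x3 => ev (S d) x3 *: (ev (S c) x2 *: x1))).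
  by apply: eq_sw => x1 x'; rewrite swZ (linZ (br _)).
by split=> ? ?; lin_tac2.
Qed.

Lemma actlr c d x : actl c (actr d x) = actr d (actl c x).
Proof.
have [_ brl] := actl_bilin; have [_ brr] := actr_bilin.
rewrite {1}/actr {2}/actl (lin_sw _ _ (brl _)) (lin_sw _ _ (brr _)).
transitivity (\sw_(x', x3 <- Δ x) \sw_(x1, x2 <- Δ x') ev (S d) x3 *: (ev c x1 *: x2)).
  by apply: eq_sw => x1 x'; rewrite swZ (linZ (brl _)).
rewrite (@sw_comulA _ _ _ (fun x1 x2 x3 => ev (S d) x3 *: (ev c x1 *: x2))).
  apply: eq_sw => x1 x'; rewrite (linZ (brr _)) -swZ.
  by apply: eq_sw => x2 x3; rewrite !scalerA mulrC.
by split=> ? ?; lin_tac2.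
Qed.

Lemma actl_mul c b x : actl c (b * x) =
  \sw_(c1, c2 <- Δ c) \sw_(b1, b2 <- Δ b) ev c2 b1 *: (b2 * actl c1 x).
Proof.
rewrite {1}/actl comulM_sw; last by apply: bilinI => ?; lin_tac2.
rewrite [RHS]exch_sw; apply: eq_sw => b1 b2.
transitivity (\sw_(x1, x2 <- Δ x) \sw_(c1, c2 <- Δ c)
   ev c1 x1 *: (ev c2 b1 *: (b2 * x2))).
  by apply: eq_sw => x1 x2; rewrite pairingMr_sw.
rewrite exch_sw; apply: eq_sw => c1 c2.
rewrite /actl /sweedler mulr_sumr scaler_sumr; apply: eq_bigr => p _.
by rewrite -scalerAr !scalerA mulrC.
Qed.

Lemma pairingSMr_sw (W : lmodType k) c b d (w : W) : ev (S c) (b * d) *: w =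
  \sw_(c1, c2 <- Δ c) ev (S c1) b *: (ev (S c2) d *: w).
Proof.
rewrite pairingS antipodeM pairingMr_sw; apply: eq_sw => c1 c2.
by rewrite -!pairingS.
Qed.

Lemma actr_mul c b x : actr c (b * x) =
  \sw_(c1, c2 <- Δ c) \sw_(b1, b2 <- Δ b) ev (S c1) b2 *: (b1 * actr c2 x).
Proof.
rewrite {1}/actr comulM_sw; last by apply: bilinI => ?; lin_tac2.
rewrite [RHS]exch_sw; apply: eq_sw => b1 b2.
transitivity (\sw_(x1, x2 <- Δ x) \sw_(c1, c2 <- Δ c)
   ev (S c1) b2 *: (ev (S c2) x2 *: (b1 * x1))).
  by apply: eq_sw => x1 x2; rewrite pairingSMr_sw.
rewrite exch_sw; apply: eq_sw => c1 c2.
rewrite /actr /sweedler mulr_sumr scaler_sumr; apply: eq_bigr => p _.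
by rewrite -scalerAr !scalerA mulrC.
Qed.

Definition actB (b : B) (t : tens B C) : tens B C :=
  \sw_(x, y <- t) (b * x) ⊗ y.
Definition actC (c : C) (t : tens B C) : tens B C :=
  \sw_(x, y <- t) \sw_(c1, c' <- Δ c) \sw_(c2, c3 <- Δ c')
     actl c3 (actr c1 x) ⊗ (c2 * y).

End Action.

Ltac lin_tac3 := repeat (cbv beta; first
  [ progress lin_tac2
  | match goal with |- lin (fun x => actl ?e (@?g x) ?a) =>
      refine (@lin_bil _ _ _ _ _ (actl e) g a (actl_bilin e) _) end
  | match goal with |- lin (fun x => actl ?e ?a (@?g x)) =>
      refine (@lin_bir _ _ _ _ _ (actl e) g a (actl_bilin e) _) end
  | match goal with |- lin (fun x => actr ?e (@?g x) ?a) =>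
      refine (@lin_bil _ _ _ _ _ (actr e) g a (actr_bilin e) _) end
  | match goal with |- lin (fun x => actr ?e ?a (@?g x)) =>
      refine (@lin_bir _ _ _ _ _ (actr e) g a (actr_bilin e) _) end ]).

Section PBW.
Variables (k : fieldType) (C B : hopfType k) (ev : weakDuality C B).
Notation S := antipode.
Notation L := (actl ev).
Notation R := (actr ev).
Notation aB := (@actB k C B).
Notation aC := (actC ev).

Lemma actB_bilin : bilin aB.
Proof.
apply: bilinI => [t|b]; rewrite /actB; first by lin_tac3.
by apply: (@lin_swt _ _ _ _ _ _ (fun x => x)); lin_tac3.
Qed.
Lemma actC_bilin : bilin aC.
Proof.
apply: bilinI => [t|b]; rewrite /actC; first by lin_tac3.
by apply: (@lin_swt _ _ _ _ _ _ (fun x => x)); lin_tac3.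
Qed.
Lemma actB_pure b x y : aB b (x ⊗ y) = (b * x) ⊗ y.
Proof. by rewrite /actB sw_pure //; apply: bilinI => ?; lin_tac3. Qed.
Lemma actC_pure c x y : aC c (x ⊗ y) =
  \sw_(c1, c' <- Δ c) \sw_(c2, c3 <- Δ c') L c3 (R c1 x) ⊗ (c2 * y).
Proof. by rewrite /actC sw_pure //; apply: bilinI => ?; lin_tac3. Qed.

Lemma actB1 t : aB 1 t = t.
Proof.
move: t; apply: tens_eqP => //; first exact: (bilinr actB_bilin).
by move=> x y; rewrite actB_pure mul1r.
Qed.
Lemma actC1 t : aC 1 t = t.
Proof.
move: t; apply: tens_eqP => //; first exact: (bilinr actC_bilin).
move=> x y; rewrite actC_pure comul1 sw_pure; last by apply: bilinI => ?; lin_tac3.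
rewrite comul1 sw_pure; last by apply: bilinI => ?; lin_tac3.
by rewrite actl1 actr1 mul1r.
Qed.
Lemma actBM b b' t : aB (b * b') t = aB b (aB b' t).
Proof.
have br := bilinr actB_bilin.
move: t; apply: tens_eqP; first exact: br.
  by apply: lin_cmp; exact: br.
by move=> x y; rewrite !actB_pure mulrA.
Qed.
Lemma actCM c d t : aC (c * d) t = aC c (aC d t).
Proof.
have br := bilinr actC_bilin.
move: t; apply: tens_eqP; first exact: br.
  by apply: lin_cmp; exact: br.
move=> x y; rewrite !actC_pure comulM_sw; last by apply: bilinI => ?; lin_tac3.
rewrite exch_sw (lin_sw _ _ (br _)); apply: eq_sw => d1 d'.
rewrite (lin_sw _ _ (br _)).
transitivity (\sw_(c1, c' <- Δ c) \sw_(c2, c3 <- Δ c') \sw_(d2, d3 <- Δ d')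
   L c3 (R c1 (L d3 (R d1 x))) ⊗ (c2 * (d2 * y))).
  apply: eq_sw => c1 c'; rewrite comulM_sw; last by apply: bilinI => ?; lin_tac3.
  apply: eq_sw => c2 c3; apply: eq_sw => d2 d3.
  by rewrite actlM actrM (actlr _ d3) mulrA.
transitivity (\sw_(c1, c' <- Δ c) \sw_(d2, d3 <- Δ d') \sw_(c2, c3 <- Δ c')
   L c3 (R c1 (L d3 (R d1 x))) ⊗ (c2 * (d2 * y))).
  by apply: eq_sw => c1 c'; rewrite exch_sw.
by rewrite exch_sw; apply: eq_sw => d2 d3; rewrite actC_pure.
Qed.

Lemma pairing_cancel (W : lmodType k) (G : B -> C -> W) b c : bilin G ->
  \sw_(c1, e <- Δ c) \sw_(p, q <- Δ e) \sw_(b', b3 <- Δ b) \sw_(b1, b2 <- Δ b')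
    ev c1 b3 *: (ev (S p) b2 *: G b1 q) = G b c.
Proof.
move=> bG.
rewrite -(@sw_comulA _ _ _ (fun c1 p q => \sw_(b', b3 <- Δ b) \sw_(b1, b2 <- Δ b')
    ev c1 b3 *: (ev (S p) b2 *: G b1 q))); last by split=> ? ?; lin_tac3.
transitivity (\sw_(c', q <- Δ c) (ε c' : k) *: G b q); last first.
  by apply: sw_counitl; apply: bilinr.
apply: eq_sw => c' q.
transitivity (\sw_(c1, p <- Δ c') \sw_(b1, b' <- Δ b) ev (c1 * S p) b' *: G b1 q).
  apply: eq_sw => c1 p.
  rewrite (@sw_comulA _ _ _ (fun b1 b2 b3 => ev c1 b3 *: (ev (S p) b2 *: G b1 q))).
    apply: eq_sw => b1 b'; rewrite pairingMl_sw; apply: eq_sw => b2 b3.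
    by rewrite !scalerA mulrC.
  by split=> ? ?; lin_tac3.
rewrite exch_sw.
transitivity (\sw_(b1, b' <- Δ b) (ε b' : k) *: ((ε c' : k) *: G b1 q)).
  apply: eq_sw => b1 b'.
  rewrite (@sw_antipoder _ _ _ (fun z => ev z b' *: G b1 q)); last by lin_tac3.
  by rewrite pairing1l !scalerA mulrC.
rewrite (@sw_counitr _ _ _ (fun z => (ε c' : k) *: G z q)) //.
by lin_tac3; apply: bilinl.
Qed.

Lemma pairing_cancelS (W : lmodType k) (G : B -> C -> W) b c : bilin G ->
  \sw_(c1, e <- Δ c) \sw_(p, q <- Δ e) \sw_(b', b3 <- Δ b) \sw_(b1, b2 <- Δ b')
    ev (S c1) b3 *: (ev p b2 *: G b1 q) = G b c.
Proof.
move=> bG.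
rewrite -(@sw_comulA _ _ _ (fun c1 p q => \sw_(b', b3 <- Δ b) \sw_(b1, b2 <- Δ b')
    ev (S c1) b3 *: (ev p b2 *: G b1 q))); last by split=> ? ?; lin_tac3.
transitivity (\sw_(c', q <- Δ c) (ε c' : k) *: G b q); last first.
  by apply: sw_counitl; apply: bilinr.
apply: eq_sw => c' q.
transitivity (\sw_(c1, p <- Δ c') \sw_(b1, b' <- Δ b) ev (S c1 * p) b' *: G b1 q).
  apply: eq_sw => c1 p.
  rewrite (@sw_comulA _ _ _ (fun b1 b2 b3 => ev (S c1) b3 *: (ev p b2 *: G b1 q))).
    apply: eq_sw => b1 b'; rewrite pairingMl_sw; apply: eq_sw => b2 b3.
    by rewrite !scalerA mulrC.
  by split=> ? ?; lin_tac3.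
rewrite exch_sw.
transitivity (\sw_(b1, b' <- Δ b) (ε b' : k) *: ((ε c' : k) *: G b1 q)).
  apply: eq_sw => b1 b'.
  rewrite (@sw_antipodel _ _ _ (fun z => ev z b' *: G b1 q)); last by lin_tac3.
  by rewrite pairing1l !scalerA mulrC.
rewrite (@sw_counitr _ _ _ (fun z => (ε c' : k) *: G z q)) //.
by lin_tac3; apply: bilinl.
Qed.

Lemma act_exchange b c t :
  \sw_(b1, b2 <- Δ b) \sw_(c1, c2 <- Δ c) ev c2 b1 *: aB b2 (aC c1 t) =
  \sw_(b1, b2 <- Δ b) \sw_(c1, c2 <- Δ c) ev c1 b2 *: aC c2 (aB b1 t).
Proof.
have brB := bilinr actB_bilin; have brC := bilinr actC_bilin.
have blB := bilinl actB_bilin; have blC := bilinl actC_bilin.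
have tl := bilinl (@tpure_bilin k B C).
move: t; apply: tens_eqP.
- apply: lin_swf => ? ?; apply: lin_swf => ? ?; apply: lin_zr.
  by apply: lin_cmp (brB _) _; apply: brC.
- apply: lin_swf => ? ?; apply: lin_swf => ? ?; apply: lin_zr.
  by apply: lin_cmp (brC _) _; apply: brB.
move=> x y.
transitivity (\sw_(c1, c' <- Δ c) \sw_(c2, c3 <- Δ c') L c3 (b * R c1 x) ⊗ (c2 * y)).
  transitivity (\sw_(c', c4 <- Δ c) \sw_(c1, c'' <- Δ c') \sw_(c2, c3 <- Δ c'')
    \sw_(b1, b2 <- Δ b) (ev c4 b1 *: (b2 * L c3 (R c1 x))) ⊗ (c2 * y)).
    rewrite exch_sw; apply: eq_sw => c' c4.
    transitivity (\sw_(c1, c'' <- Δ c') \sw_(b1, b2 <- Δ b) \sw_(c2, c3 <- Δ c'')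
       (ev c4 b1 *: (b2 * L c3 (R c1 x))) ⊗ (c2 * y)).
      rewrite exch_sw; apply: eq_sw => b1 b2.
      rewrite actC_pure (lin_sw _ _ (brB _)) -swZ; apply: eq_sw => c1 c''.
      rewrite (lin_sw _ _ (brB _)) -swZ; apply: eq_sw => c2 c3.
      by rewrite actB_pure (linZ (tl _)).
    by apply: eq_sw => c1 c''; rewrite exch_sw.
  rewrite (@sw_comulA _ _ _ (fun c1 c'' c4 => \sw_(c2, c3 <- Δ c'')
    \sw_(b1, b2 <- Δ b) (ev c4 b1 *: (b2 * L c3 (R c1 x))) ⊗ (c2 * y))); last first.
    by split=> ? ?; lin_tac3.
  apply: eq_sw => c1 e.
  rewrite (@sw_comulA _ _ _ (fun c2 c3 c4 => 
    \sw_(b1, b2 <- Δ b) (ev c4 b1 *: (b2 * L c3 (R c1 x))) ⊗ (c2 * y))); last first.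
    by split=> ? ?; lin_tac3.
  apply: eq_sw => c2 f; rewrite actl_mul (lin_sw _ _ (tl _)).
  by apply: eq_sw => c3 c4; rewrite (lin_sw _ _ (tl _)).
pose G e' b' q := \sw_(e2, e3 <- Δ e') L e3 (b' * R q x) ⊗ (e2 * y).
have bG e' : bilin (G e') by rewrite /G; apply: bilinI => ?; lin_tac3.
transitivity (\sw_(f, e' <- Δ c) G e' b f); first by [].
transitivity (\sw_(f, e' <- Δ c) \sw_(c1, e1 <- Δ f) \sw_(p, q <- Δ e1)
    \sw_(b', b3 <- Δ b) \sw_(b1, b2 <- Δ b')
      ev c1 b3 *: (ev (S p) b2 *: G e' b1 q)).
  by apply: eq_sw => f e'; rewrite pairing_cancel.
have lG1 e b' : lin (fun q => G e b' q) by apply: bilinr.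
have lG2 e q : lin (fun b' => G e b' q) by apply: bilinl.
have lG3 b' q : lin (fun e => G e b' q) by rewrite /G; lin_tac3.
rewrite (@sw_comulA _ _ _ (fun c1 e1 e' => \sw_(p, q <- Δ e1)
    \sw_(b', b3 <- Δ b) \sw_(b1, b2 <- Δ b')
      ev c1 b3 *: (ev (S p) b2 *: G e' b1 q))); last first.
  by split=> ? ?; lin_tac3.
rewrite [RHS]exch_sw; apply: eq_sw => c1 e.
transitivity (\sw_(b', b3 <- Δ b) \sw_(e1, e' <- Δ e) \sw_(p, q <- Δ e1)
     \sw_(b1, b2 <- Δ b') ev c1 b3 *: (ev (S p) b2 *: G e' b1 q)).
  rewrite [RHS]exch_sw; apply: eq_sw => e1 e'.
  by rewrite [RHS]exch_sw.
apply: eq_sw => b' b3; rewrite actB_pure actC_pure -swZ; apply: eq_sw => e1 e'.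
rewrite actr_mul.
transitivity (ev c1 b3 *: \sw_(p, q <- Δ e1) \sw_(b1, b2 <- Δ b')
     (ev (S p) b2 *: G e' b1 q)).
  by rewrite -swZ; apply: eq_sw => p q; rewrite -swZ.
congr (_ *: _).
pose H z := \sw_(e2, e3 <- Δ e') L e3 z ⊗ (e2 * y).
have lH : lin H by rewrite /H; lin_tac3.
rewrite -/(H _) (lin_sw _ _ lH); apply: eq_sw => p q.
rewrite (lin_sw _ _ lH); apply: eq_sw => b1 b2.
by rewrite (linZ lH).
Qed.

Fixpoint dterm_act (x : dterm C B) (t : tens B C) : tens B C :=
  match x with
  | dB b => aB b t
  | dC c => aC c t
  | dadd x y => dterm_act x t + dterm_act y t
  | dscale a x => a *: dterm_act x t
  | dmul x y => dterm_act x (dterm_act y t)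
  end.

Lemma lin_dterm_act x : lin (dterm_act x).
Proof.
elim: x => [b|c|x hx y hy|a x hx|x hx y hy] /=.
- exact: (bilinr actB_bilin).
- exact: (bilinr actC_bilin).
- exact: lin_add.
- exact: lin_zr.
- exact: lin_cmp hx hy.
Qed.

Lemma dterm_actP x y : dcong ev x y -> forall t, dterm_act x t = dterm_act y t.
Proof.
have lB t := bilinl actB_bilin t; have lC t := bilinl actC_bilin t.
elim=> {x y} //=.
- by move=> x y z _ h1 _ h2 t; rewrite h1 h2.
- by move=> x x' y y' _ h1 _ h2 t; rewrite h1 h2.
- by move=> a x x' _ h t; rewrite h.
- by move=> x x' y y' _ h1 _ h2 t; rewrite h1 h2.
- by move=> x y z t; rewrite addrA.
- by move=> x y t; rewrite addrC.
- by move=> x t; rewrite (lin0 (lB t)) add0r.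
- by move=> x t; rewrite (lin0 (lB t)) scaleN1r addNr.
- by move=> a b x t; rewrite scalerA.
- by move=> x t; rewrite scale1r.
- by move=> a x y t; rewrite scalerDr.
- by move=> a b x t; rewrite scalerDl.
- by move=> x t; rewrite actB1.
- by move=> x t; rewrite actB1.
- by move=> x y z t; rewrite (linD (lin_dterm_act x)).
- by move=> a x y t; rewrite (linZ (lin_dterm_act x)).
- by move=> b b' t; exact: (linD (lB t)).
- by move=> a b t; exact: (linZ (lB t)).
- by move=> b b' t; exact: actBM.
- by move=> b b' t; exact: (linD (lC t)).
- by move=> a b t; exact: (linZ (lC t)).
- by move=> b b' t; exact: actCM.
- by move=> t; rewrite actB1 actC1.
move=> b c t.
rewrite (@dsum_sw _ _ _ _ (dterm_act^~ t) b c
  (fun b1 b2 c1 c2 => dscale (ev c2 b1) (dmul (dB _ b2) (dC _ c1)))) //=; last exact: (lin0 (lB t)).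
rewrite (@dsum_sw _ _ _ _ (dterm_act^~ t) b c
  (fun b1 b2 c1 c2 => dscale (ev c1 b2) (dmul (dC _ c2) (dB _ b1)))) //=; last exact: (lin0 (lB t)).
exact: act_exchange.
Qed.

Definition drin_pbw (t : tens B C) : Drin ev :=
  \sw_(b, c <- t) drinB ev b * drinC ev c.

(* drin_coord is the inverse of drin_pbw: it lets x act on 1 ⊗ 1, where drin_pbw
   turns the action into left multiplication; see drin_pbwK and drin_coordK. *)
Definition drin_coord (x : Drin ev) : tens B C := dterm_act (repr x) (1 ⊗ 1).

Lemma drin_coord_pi x : drin_coord (\pi_(Drin ev) x) = dterm_act x (1 ⊗ 1).
Proof. by apply: dterm_actP; exact: drin_reprP. Qed.

Lemma drin_pbw_bilin : bilin (fun b c => drinB ev b * drinC ev c).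
Proof. by apply: bilinI => ?; lin_tac3. Qed.

Lemma lin_drin_pbw : lin drin_pbw.
Proof. exact: (sw_lin drin_pbw_bilin). Qed.

Lemma drin_pbw_pure b c : drin_pbw (b ⊗ c) = drinB ev b * drinC ev c.
Proof. exact: (sw_pure _ _ drin_pbw_bilin). Qed.

Lemma lin_drin_coord : lin drin_coord.
Proof.
move=> a x y; elim/drin_ind_pi: x => x; elim/drin_ind_pi: y => y.
by rewrite -drin_piZ -drin_piD !drin_coord_pi.
Qed.

Lemma drin_pbwK : cancel drin_pbw drin_coord.
Proof.
apply: tens_eqP => //; first exact: lin_cmp lin_drin_coord lin_drin_pbw.
move=> b c; rewrite drin_pbw_pure -drin_piM drin_coord_pi /=.
rewrite actC_pure.
transitivity (aB b (1 ⊗ c)); last by rewrite actB_pure mulr1.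
congr (aB b _).
have L1 c' : L c' 1 = ε c' *: 1.
  rewrite /actl comul1 sw_pure ?pairing1r //.
  by apply: bilinI => ?; lin_tac3.
have R1 c' : R c' 1 = ε c' *: 1.
  rewrite /actr comul1 sw_pure ?pairing1r ?counit_antipode //.
  by apply: bilinI => ?; lin_tac3.
transitivity (\sw_(c1, c' <- Δ c) (ε c1 : k) *: ((1 : B) ⊗ c')); last first.
  by rewrite (@sw_counitl _ _ _ (fun z => 1 ⊗ z)) //; lin_tac3.
apply: eq_sw => c1 c'.
transitivity (\sw_(c2, c3 <- Δ c') (ε c3 : k) *: ((ε c1 : k) *: ((1 : B) ⊗ c2))).
  apply: eq_sw => c2 c3.
  rewrite R1 (linZ (bilinr (actl_bilin ev) _)) L1 mulr1.
  by rewrite !(linZ (bilinl (@tpure_bilin k B C) _)) !scalerA mulrC.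
rewrite (@sw_counitr _ _ _ (fun z => (ε c1 : k) *: ((1 : B) ⊗ z))) //.
by lin_tac3.
Qed.

Lemma drin_pbw_actB b t : drin_pbw (aB b t) = drinB ev b * drin_pbw t.
Proof.
have lp := lin_drin_pbw.
move: t; apply: tens_eqP.
- exact: lin_cmp lp (bilinr actB_bilin b).
- exact: (@lin_mr k _ (Drin ev) (drinB ev b) drin_pbw lp).
by move=> x y; rewrite actB_pure !drin_pbw_pure drinBM mulrA.
Qed.

Lemma drin_straighten c x : drinC ev c * drinB ev x =
  \sw_(c1, c' <- Δ c) \sw_(c2, c3 <- Δ c') drinB ev (L c3 (R c1 x)) * drinC ev c2.
Proof.
pose G (b : B) (c : C) := drinC ev c * drinB ev b.
have bG : bilin G by rewrite /G; apply: bilinI => ?; lin_tac3.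
transitivity (G x c) => //; rewrite -pairing_cancelS //; apply: eq_sw => c1 c'.
pose P (z : B) := \sw_(z1, z2 <- Δ z) \sw_(c2, c3 <- Δ c') ev c2 z2 *: G z1 c3.
have lP : lin P by rewrite /P; lin_tac3.
transitivity (P (R c1 x)).
  rewrite /actr (lin_sw _ _ lP) exch_sw; apply: eq_sw => x' x3.
  rewrite (linZ lP) /P exch_sw -swZ; apply: eq_sw => x1 x2.
  by rewrite -swZ.
rewrite /P -drin_exchange exch_sw; apply: eq_sw => c2 c3.
pose Q (z : B) := drinB ev z * drinC ev c2.
have lQ : lin Q by rewrite /Q; lin_tac3.
rewrite -/(Q _) /actl (lin_sw _ _ lQ); apply: eq_sw => z1 z2.
by rewrite (linZ lQ).
Qed.

Lemma drin_pbw_actC c t : drin_pbw (aC c t) = drinC ev c * drin_pbw t.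
Proof.
have lp := lin_drin_pbw.
move: t; apply: tens_eqP.
- exact: lin_cmp lp (bilinr actC_bilin c).
- exact: (@lin_mr k _ (Drin ev) (drinC ev c) drin_pbw lp).
move=> x y; rewrite actC_pure drin_pbw_pure mulrA drin_straighten.
pose Q (z : Drin ev) := z * drinC ev y.
have lQ : lin Q by rewrite /Q; lin_tac3.
rewrite -/(Q _) (lin_sw _ _ lp) (lin_sw _ _ lQ); apply: eq_sw => c1 c'.
rewrite (lin_sw _ _ lp) (lin_sw _ _ lQ); apply: eq_sw => c2 c3.
by rewrite drin_pbw_pure drinCM mulrA.
Qed.

Lemma drin_coordK : cancel drin_coord drin_pbw.
Proof.
suff h x t : drin_pbw (dterm_act x t) = \pi_(Drin ev) x * drin_pbw t.
  move=> x; rewrite /drin_coord h reprK drin_pbw_pure.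
  by rewrite drinB1 drinC1 !mulr1.
have lp := lin_drin_pbw.
elim: x t => [b|c|x hx y hy|a x hx|x hx y hy] t /=.
- exact: drin_pbw_actB.
- exact: drin_pbw_actC.
- by rewrite (linD lp) hx hy drin_piD mulrDl.
- by rewrite (linZ lp) hx drin_piZ scalerAl.
- by rewrite hx hy drin_piM mulrA.
Qed.

Lemma drin_pbw_bij : bijective drin_pbw.
Proof. by exists drin_coord; [exact: drin_pbwK | exact: drin_coordK]. Qed.

End PBW.

Section Cocycles.
Variables (k : fieldType) (E : bialgType k).
Implicit Types (f g sigma : E -> E -> k).

Definition conv2 f g (x y : E) : k :=
  \sw_(x1, x2 <- Δ x) \sw_(y1, y2 <- Δ y) f x1 y1 * g x2 y2.

Definition conv2_invertible f : Prop :=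
  exists g, [/\ biform g,
    forall x y, conv2 f g x y = ε x * ε y
  & forall x y, conv2 g f x y = ε x * ε y].

Record right_cocycle sigma : Prop := RightCocycle {
  right_cocycle_biform : biform sigma;
  right_cocycle_inv : conv2_invertible sigma;
  right_cocycleE : forall x y z,
    \sw_(y1, y2 <- Δ y) \sw_(z1, z2 <- Δ z) sigma x (y1 * z1) * sigma y2 z2 =
    \sw_(x1, x2 <- Δ x) \sw_(y1, y2 <- Δ y) sigma (x1 * y1) z * sigma x2 y2;
  right_cocycle1r : forall x, sigma x 1 = ε x;
  right_cocycle1l : forall x, sigma 1 x = ε x
}.

Record left_cocycle sigma : Prop := LeftCocycle {
  left_cocycle_biform : biform sigma;
  left_cocycle_inv : conv2_invertible sigma;
  left_cocycleE : forall x y z,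
    \sw_(x1, x2 <- Δ x) \sw_(y1, y2 <- Δ y) sigma x1 y1 * sigma (x2 * y2) z =
    \sw_(y1, y2 <- Δ y) \sw_(z1, z2 <- Δ z) sigma y1 z1 * sigma x (y2 * z2);
  left_cocycle1r : forall x, sigma x 1 = ε x;
  left_cocycle1l : forall x, sigma 1 x = ε x
}.

Definition right_twist sigma (x y : E) : E :=
  \sw_(x1, x2 <- Δ x) \sw_(y1, y2 <- Δ y) sigma x2 y2 *: (x1 * y1).

Definition left_twist sigma (x y : E) : E :=
  \sw_(x1, x2 <- Δ x) \sw_(y1, y2 <- Δ y) sigma x1 y1 *: (x2 * y2).

End Cocycles.

Record algebra_product (k : fieldType) (V : lmodType k)
    (m : V -> V -> V) (e : V) : Prop := AlgebraProduct {
  algebra_product_bilin : bilin m;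
  algebra_productA : associative m;
  algebra_product1l : left_id e m;
  algebra_product1r : right_id e m
}.

Section DrinCocycle.
Variables (k : fieldType) (C B : hopfType k) (ev : weakDuality C B).
Variables (sigma : B -> B -> k) (tau : C -> C -> k).

(* drin_coord reads x as a sum of products b c. *)
Definition cocycle_comp (x y : Drin ev) : k :=
  \sw_(b, c <- drin_coord x) \sw_(b', c' <- drin_coord y)
    \sw_(b1, b2 <- Δ b') \sw_(c1, c2 <- Δ c) sigma b b2 * tau c1 c' * ev c2 b1.

(* The right twist of Drin, transported to B ⊗ C along b ⊗ c |-> b c. *)
Definition drin_twist (s t : tens B C) : tens B C :=
  drin_coord (right_twist cocycle_comp (drin_pbw ev s) (drin_pbw ev t)).

End DrinCocycle.

(* Main.v *)
Require Import Defs.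
From mathcomp Require Import all_boot all_algebra.

Set Implicit Arguments.
Unset Strict Implicit.
Unset Printing Implicit Defensive.

Import GRing.Theory.
Local Open Scope ring_scope.

(** The coalgebra of Drin is that of the tensor product of B with the co-opposite
    of C, so chi = sigma ∘ tau can be read as a convolution product
    ev(q x, p y) * sigma(p x, p y) * tau(q x, q y) of forms pulled back along the
    coalgebra projections p : bc |-> ε(c) b and q : bc |-> ε(b) c
    ([cocycle_comp_conv]). Each factor is invertible (the inverse of ev is
    ev ∘ (S ⊗ id)), hence so is chi.

    The cocycle identity of chi, which would need long Sweedler manipulations,
    is obtained from associativity. For any bilinear form s, the identity
    ε(m_s(x, y)) = s(x, y) shows that applying ε to the associativity of m_s
    gives exactly the right cocycle identity of s ([right_twistA_cocycle]); the
    converse follows from the left colinearity of m_s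
    ([comul_right_twist], [right_twistA]). It is therefore enough to compute the
    twisted product of Drin and to see that it is associative.

    One application of the exchange relation of Drin turns the twisted product
    into the product of B ⊗ C displayed in the theorem ([right_twist_pbw]). That
    product is the twisted tensor product of the
    algebras (B, m_sigma) and (C, m_tau) along c ⊗ b |-> b_(2) ⊗ c_(1)
    ev(c_(2), b_(1)). It is associative because m_sigma is left B-colinear, m_tau
    is right C-colinear and ev is multiplicative in each variable
    ([twisted_tmulA]). *)

(** * Sweedler sums *)

Section Sweedler.
Variable k : fieldType.

Lemma sw_mull (U V : lmodType k) (f : U -> V -> k) a t :
  \sw_(u, v <- t) a * f u v = a * \sw_(u, v <- t) f u v.
Proof. by rewrite /sweedler mulr_sumr. Qed.

Lemma sw_mulr (U V : lmodType k) (f : U -> V -> k) a t :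
  \sw_(u, v <- t) f u v * a = (\sw_(u, v <- t) f u v) * a.
Proof. by rewrite /sweedler mulr_suml. Qed.

Lemma sw_scalel (U V W : lmodType k) (f : U -> V -> k) (w : W) t :
  \sw_(u, v <- t) f u v *: w = (\sw_(u, v <- t) f u v) *: w.
Proof. by rewrite /sweedler scaler_suml. Qed.

Lemma sw_counitlk (X : coalgType k) (f : X -> k) x : @lin k X k^o f ->
  \sw_(a, b <- Δ x) ε a * f b = f x.
Proof. exact: (@sw_counitl k X k^o). Qed.

Lemma sw_counitrk (X : coalgType k) (f : X -> k) x : @lin k X k^o f ->
  \sw_(a, b <- Δ x) ε b * f a = f x.
Proof. exact: (@sw_counitr k X k^o). Qed.

(** Coassociativity in two coalgebras at once; being separately trilinear
    suffices, as the two sums can be reassociated one after the other. *)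
Lemma sw_comulA2 (X Y : coalgType k) (W : lmodType k)
    (F : X -> X -> X -> Y -> Y -> Y -> W) x y :
  (forall y1 y2 y3, trilin (fun x1 x2 x3 => F x1 x2 x3 y1 y2 y3)) ->
  (forall x1 x2 x3, trilin (F x1 x2 x3)) ->
  \sw_(x', x3 <- Δ x) \sw_(y', y3 <- Δ y)
    \sw_(x1, x2 <- Δ x') \sw_(y1, y2 <- Δ y') F x1 x2 x3 y1 y2 y3 =
  \sw_(x1, x' <- Δ x) \sw_(y1, y' <- Δ y)
    \sw_(x2, x3 <- Δ x') \sw_(y2, y3 <- Δ y') F x1 x2 x3 y1 y2 y3.
Proof.
move=> FX FY.
transitivity (\sw_(x', x3 <- Δ x) \sw_(x1, x2 <- Δ x')
    \sw_(y1, y' <- Δ y) \sw_(y2, y3 <- Δ y') F x1 x2 x3 y1 y2 y3).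
  apply: eq_sw => x' x3; rewrite exch_sw; apply: eq_sw => x1 x2.
  exact: sw_comulA.
rewrite (@sw_comulA _ _ _ (fun x1 x2 x3 => \sw_(y1, y' <- Δ y)
    \sw_(y2, y3 <- Δ y') F x1 x2 x3 y1 y2 y3)).
  by apply: eq_sw => x1 x'; rewrite exch_sw.
split=> ? ? /=; apply: lin_swf => y1 y'; apply: lin_swf => y2 y3;
  by have [] := FX y1 y2 y3.
Qed.

(** The same with the two factors split on opposite sides, as happens in Drin,
    where the coproduct of C is reversed. *)
Lemma sw_comulA2_opp (X Y : coalgType k) (W : lmodType k)
    (F : X -> X -> X -> Y -> Y -> Y -> W) x y :
  (forall y1 y2 y3, trilin (fun x1 x2 x3 => F x1 x2 x3 y1 y2 y3)) ->
  (forall x1 x2 x3, trilin (F x1 x2 x3)) ->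
  \sw_(x1, x' <- Δ x) \sw_(y', y3 <- Δ y)
    \sw_(x2, x3 <- Δ x') \sw_(y1, y2 <- Δ y') F x1 x2 x3 y1 y2 y3 =
  \sw_(x', x3 <- Δ x) \sw_(y1, y' <- Δ y)
    \sw_(x1, x2 <- Δ x') \sw_(y2, y3 <- Δ y') F x1 x2 x3 y1 y2 y3.
Proof.
move=> FX FY.
transitivity (\sw_(x1, x' <- Δ x) \sw_(x2, x3 <- Δ x')
    \sw_(y1, y' <- Δ y) \sw_(y2, y3 <- Δ y') F x1 x2 x3 y1 y2 y3).
  apply: eq_sw => x1 x'; rewrite exch_sw; apply: eq_sw => x2 x3.
  exact: sw_comulA.
rewrite -(@sw_comulA _ _ _ (fun x1 x2 x3 => \sw_(y1, y' <- Δ y)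
    \sw_(y2, y3 <- Δ y') F x1 x2 x3 y1 y2 y3)).
  by apply: eq_sw => x' x3; rewrite exch_sw.
split=> ? ? /=; apply: lin_swf => y1 y'; apply: lin_swf => y2 y3;
  by have [] := FX y1 y2 y3.
Qed.

End Sweedler.

(** * The convolution algebra of bilinear forms *)

Section Convolution.
Variables (k : fieldType) (X Y : coalgType k).
Implicit Types f g h : X -> Y -> k.

(** At X = Y = E this is [conv2]. Two coalgebras are needed because the pairing
    of C with B is one of the factors of the cocycle. *)
Definition conv f g (x : X) (y : Y) : k :=
  \sw_(x1, x2 <- Δ x) \sw_(y1, y2 <- Δ y) f x1 y1 * g x2 y2.

Definition conv_invertible f : Prop :=
  exists g, [/\ biform g,
    forall x y, conv f g x y = ε x * ε y
  & forall x y, conv g f x y = ε x * ε y].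

Lemma conv_biform f g : biform f -> biform g -> biform (conv f g).
Proof. by move=> bf bg; rewrite /conv; lin_tac. Qed.

Lemma eq_conv f f' g g' : f =2 f' -> g =2 g' -> conv f g =2 conv f' g'.
Proof.
by move=> e e' x y; apply: eq_sw => x1 x2; apply: eq_sw => y1 y2; rewrite e e'.
Qed.

Lemma conv_counitl f : biform f -> conv (fun x y => ε x * ε y) f =2 f.
Proof.
move=> bf x y; rewrite -[RHS](@sw_counitlk _ _ (f^~ y)); last by lin_tac.
apply: eq_sw => x1 x2; rewrite -(@sw_counitlk _ _ (f x2) y); last exact: (bilinr bf).
by rewrite -sw_mull; apply: eq_sw => y1 y2; rewrite mulrA.
Qed.

Lemma convA f g h : biform f -> biform g -> biform h ->
  conv (conv f g) h =2 conv f (conv g h).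
Proof.
move=> bf bg bh x y.
transitivity (\sw_(x', x3 <- Δ x) \sw_(y', y3 <- Δ y)
    \sw_(x1, x2 <- Δ x') \sw_(y1, y2 <- Δ y') f x1 y1 * g x2 y2 * h x3 y3).
  apply: eq_sw => x' x3; apply: eq_sw => y' y3; rewrite /conv -sw_mulr.
  by apply: eq_sw => x1 x2; rewrite sw_mulr.
rewrite (@sw_comulA2 k X Y k^o
  (fun x1 x2 x3 y1 y2 y3 => f x1 y1 * g x2 y2 * h x3 y3)).
- apply: eq_sw => x1 x'; apply: eq_sw => y1 y'; rewrite /conv -sw_mull.
  apply: eq_sw => x2 x3; rewrite -sw_mull.
  by apply: eq_sw => y2 y3; rewrite mulrA.
- by split=> ? ?; lin_tac.
- by split=> ? ?; lin_tac.
Qed.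

Lemma conv_invertible_conv f g : biform f -> biform g ->
  conv_invertible f -> conv_invertible g -> conv_invertible (conv f g).
Proof.
move=> bf bg [f' [bf' ff' f'f]] [g' [bg' gg' g'g]].
have cancel_mid u u' v v' : biform u -> biform u' -> biform v -> biform v' ->
    (forall x y, conv v v' x y = ε x * ε y) ->
    conv (conv u v) (conv v' u') =2 conv u u'.
  move=> bu bu' bv bv' vv' x y; rewrite convA //; last exact: conv_biform.
  apply: eq_conv => // {x y} x y; rewrite -convA //.
  by rewrite -(conv_counitl bu'); apply: eq_conv.
exists (conv g' f'); split; first exact: conv_biform.
  by move=> x y; rewrite cancel_mid.
by move=> x y; rewrite cancel_mid.
Qed.

Lemma eq_conv_invertible f g : f =2 g -> conv_invertible f -> conv_invertible g.
Proof.
move=> e [f' [bf' ff' f'f]]; exists f'; split=> // x y.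
  by rewrite -ff'; apply: eq_conv.
by rewrite -f'f; apply: eq_conv.
Qed.

End Convolution.

Section CoalgebraMorphism.
Variable k : fieldType.

Record coalg_morph (X X' : coalgType k) (p : X -> X') : Prop := CoalgMorph {
  coalg_morph_lin : lin p;
  coalg_morph_comul : forall x, Δ (p x) = \sw_(x1, x2 <- Δ x) p x1 ⊗ p x2;
  coalg_morph_counit : forall x, ε (p x) = ε x
}.

Lemma coalg_morph_sw (X X' : coalgType k) (p : X -> X') (W : lmodType k)
    (f : X' -> X' -> W) x : coalg_morph p -> bilin f ->
  sweedler f (Δ (p x)) = \sw_(x1, x2 <- Δ x) f (p x1) (p x2).
Proof.
move=> hp bf; rewrite (coalg_morph_comul hp) (lin_sw _ _ (sw_lin bf)).
by apply: eq_sw => x1 x2; rewrite sw_pure.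
Qed.

Variables (X X' Y Y' : coalgType k) (p : X -> X') (q : Y -> Y').
Implicit Types f g : X' -> Y' -> k.

Lemma biform_pullback f : lin p -> lin q -> biform f ->
  biform (fun x y => f (p x) (q y)).
Proof. by move=> lp lq bf; lin_tac. Qed.

Lemma conv_pullback f g : coalg_morph p -> coalg_morph q ->
  biform f -> biform g -> forall x y,
  conv (fun x y => f (p x) (q y)) (fun x y => g (p x) (q y)) x y =
  conv f g (p x) (q y).
Proof.
move=> hp hq bf bg x y; rewrite /conv.
rewrite (@coalg_morph_sw X X' p k^o (fun x1 x2 => 
  \sw_(y1, y2 <- Δ (q y)) f x1 y1 * g x2 y2)) //; last by lin_tac.
apply: eq_sw => x1 x2.
rewrite (@coalg_morph_sw Y Y' q k^o (fun y1 y2 => f (p x1) y1 * g (p x2) y2)) //.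
by lin_tac.
Qed.

(** Pullback along coalgebra morphisms is a morphism of convolution algebras, so
    it carries inverses to inverses. *)
Lemma conv_invertible_pullback f : coalg_morph p -> coalg_morph q ->
  biform f -> conv_invertible f ->
  conv_invertible (fun x y => f (p x) (q y)).
Proof.
move=> hp hq bf [g [bg fg gf]]; exists (fun x y => g (p x) (q y)).
split; first exact: (biform_pullback (coalg_morph_lin hp) (coalg_morph_lin hq)).
  move=> x y; rewrite conv_pullback // fg.
  by rewrite (coalg_morph_counit hp) (coalg_morph_counit hq).
move=> x y; rewrite conv_pullback // gf.
by rewrite (coalg_morph_counit hp) (coalg_morph_counit hq).
Qed.

End CoalgebraMorphism.

(** * Twisted products and the cocycle identity *)

Section RightTwist.
Variables (k : fieldType) (E : bialgType k) (s : E -> E -> k).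
Notation m := (right_twist s).

Lemma right_twist_bilin : biform s -> bilin m.
Proof. by move=> bs; apply: bilinI => ?; rewrite /right_twist; lin_tac. Qed.

Lemma counit_right_twist x y : biform s -> ε (m x y) = s x y :> k.
Proof.
move=> bs; have le := @lin_counit k E.
rewrite -[RHS](@conv_counitl _ _ _ s bs) /right_twist (lin_sw _ _ le).
apply: eq_sw => x1 x2; rewrite (lin_sw _ _ le); apply: eq_sw => y1 y2.
by rewrite (linZ le) [LHS]mulrC counitM.
Qed.

(** Left colinearity of m, tested against an arbitrary bilinear f: the form s
    sits on the last Sweedler legs, so the coproduct only sees the untwisted
    product on the first ones. *)
Lemma comul_right_twist (W : lmodType k) (f : E -> E -> W) x y :
  biform s -> bilin f ->
  sweedler f (Δ (m x y)) =
  \sw_(x1, x2 <- Δ x) \sw_(y1, y2 <- Δ y) f (x1 * y1) (m x2 y2).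
Proof.
move=> bs bf.
have lf : lin (fun z => sweedler f (Δ z)) by lin_tac.
rewrite {1}/right_twist (lin_sw _ _ lf).
transitivity (\sw_(x', x3 <- Δ x) \sw_(y', y3 <- Δ y)
    \sw_(x1, x2 <- Δ x') \sw_(y1, y2 <- Δ y')
      s x3 y3 *: f (x1 * y1) (x2 * y2)).
  apply: eq_sw => x' x3; rewrite (lin_sw _ _ lf); apply: eq_sw => y' y3.
  rewrite (linZ lf) comulM_sw // -swZ; apply: eq_sw => x1 x2.
  by rewrite swZ.
rewrite (@sw_comulA2 k E E W
  (fun x1 x2 x3 y1 y2 y3 => s x3 y3 *: f (x1 * y1) (x2 * y2))).
- apply: eq_sw => x1 x'; apply: eq_sw => y1 y'.
  rewrite (lin_sw _ _ (bilinr bf _)); apply: eq_sw => x2 x3.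
  rewrite (lin_sw _ _ (bilinr bf _)); apply: eq_sw => y2 y3.
  by rewrite (linZ (bilinr bf _)).
- by split=> ? ?; lin_tac.
- by split=> ? ?; lin_tac.
Qed.

(** The right-hand sides of this lemma and of the next are the two sides of the
    right cocycle identity, which thus reads s (m x y) z = s x (m y z). *)
Lemma form_right_twistl x y z : biform s ->
  s (m x y) z = \sw_(x1, x2 <- Δ x) \sw_(y1, y2 <- Δ y) s (x1 * y1) z * s x2 y2.
Proof.
move=> bs; have ls := bilinl bs z.
rewrite (lin_sw _ _ ls); apply: eq_sw => x1 x2.
rewrite (lin_sw _ _ ls); apply: eq_sw => y1 y2.
by rewrite (linZ ls) [LHS]mulrC.
Qed.

Lemma form_right_twistr x y z : biform s ->
  s x (m y z) = \sw_(y1, y2 <- Δ y) \sw_(z1, z2 <- Δ z) s x (y1 * z1) * s y2 z2.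
Proof.
move=> bs; have ls := bilinr bs x.
rewrite (lin_sw _ _ ls); apply: eq_sw => y1 y2.
rewrite (lin_sw _ _ ls); apply: eq_sw => z1 z2.
by rewrite (linZ ls) [LHS]mulrC.
Qed.

(** Since s x y = ε (m x y), both sides of the cocycle identity are the counits
    of the two bracketings of a triple product. *)
Lemma right_twistA_cocycle : biform s -> associative m -> forall x y z,
  \sw_(y1, y2 <- Δ y) \sw_(z1, z2 <- Δ z) s x (y1 * z1) * s y2 z2 =
  \sw_(x1, x2 <- Δ x) \sw_(y1, y2 <- Δ y) s (x1 * y1) z * s x2 y2.
Proof.
move=> bs mA x y z; rewrite -form_right_twistr // -form_right_twistl //.
by rewrite -!counit_right_twist // mA.
Qed.

(** By colinearity both bracketings are sums of s (m x2 y2) z2, respectively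
    s x2 (m y2 z2), times x1 y1 z1, and these scalars agree. *)
Lemma right_twistA : right_cocycle s -> associative m.
Proof.
case=> bs _ cs _ _ x y z; symmetry.
have bm := right_twist_bilin bs.
rewrite {1}/right_twist comul_right_twist //; last by lin_tac.
rewrite [RHS](_ : _ = \sw_(x1, x2 <- Δ x) \sw_(y1, y2 <- Δ y)
  \sw_(z1, z2 <- Δ z) s x2 (m y2 z2) *: (x1 * (y1 * z1))).
  apply: eq_sw => x1 x2; apply: eq_sw => y1 y2; apply: eq_sw => z1 z2.
  by rewrite form_right_twistl // -cs -form_right_twistr // mulrA.
rewrite {1}/right_twist; apply: eq_sw => x1 x2.
rewrite (@comul_right_twist _ (fun u v => s x2 v *: (x1 * u))) //.
by lin_tac.
Qed.

Lemma right_twist1l : right_cocycle s -> left_id 1 m.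
Proof.
case=> bs _ _ _ s1 x; rewrite /right_twist comul1 sw_pure; last by lin_tac.
rewrite -[RHS]counitr; apply: eq_sw => x1 x2.
by rewrite s1 mul1r.
Qed.

Lemma right_twist1r : right_cocycle s -> right_id 1 m.
Proof.
case=> bs _ _ s1 _ x; rewrite /right_twist -[RHS]counitr.
apply: eq_sw => x1 x2; rewrite comul1 sw_pure; last by lin_tac.
by rewrite s1 mulr1.
Qed.

End RightTwist.

(** * Left twists as right twists of the co-opposite bialgebra *)

Section LeftTwist.
Variables (k : fieldType) (E : bialgType k) (t : E -> E -> k).

Lemma sw_cop (W : lmodType k) (f : E -> E -> W) x : bilin f ->
  @sweedler k (cop E) (cop E) W f (@comul k (cop E) x) =
  \sw_(a, b <- @comul k E x) f b a.
Proof. exact: cop_sw. Qed.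

Lemma sw_copk (f : E -> E -> k) x : biform f ->
  @sweedler k (cop E) (cop E) k f (@comul k (cop E) x) =
  \sw_(a, b <- @comul k E x) f b a.
Proof. exact: (@sw_cop k^o). Qed.

Lemma left_twist_cop x y : biform t ->
  @right_twist k (cop E) t x y = @left_twist k E t x y.
Proof.
move=> bt; rewrite /right_twist.
rewrite (@sw_cop _ (fun x1 x2 : E =>
  \sw_(y1, y2 <- @comul k (cop E) y) t x2 y2 *: (x1 * y1))); last by lin_tac.
apply: eq_sw => x1 x2.
by rewrite (@sw_cop _ (fun y1 y2 : E => t x1 y2 *: (x2 * y1))) //; lin_tac.
Qed.

Lemma left_twist_bilin : biform t -> bilin (left_twist t).
Proof. by move=> bt; apply: bilinI => ?; rewrite /left_twist; lin_tac. Qed.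

Lemma comul_left_twist (W : lmodType k) (f : E -> E -> W) x y :
  biform t -> bilin f ->
  sweedler f (Δ (left_twist t x y)) =
  \sw_(x1, x2 <- Δ x) \sw_(y1, y2 <- Δ y) f (left_twist t x1 y1) (x2 * y2).
Proof.
move=> bt bf; have bl := left_twist_bilin bt.
have := @comul_right_twist k (cop E) t W (fun u v => f v u) x y bt.
rewrite left_twist_cop // (@sw_cop _ (fun u v => f v u)); last by lin_tac.
move=> -> //; last by lin_tac.
transitivity (@sweedler k (cop E) (cop E) W (fun x1 x2 : E =>
  \sw_(y1, y2 <- @comul k (cop E) y) f (left_twist t x2 y2) (x1 * y1))
    (@comul k (cop E) x)).
  by apply: eq_sw => x1 x2; apply: eq_sw => y1 y2; rewrite left_twist_cop.
rewrite sw_cop; last by lin_tac.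
apply: eq_sw => x1 x2.
by rewrite (@sw_cop _ (fun y1 y2 : E => f (left_twist t x1 y2) (x2 * y1))) //; lin_tac.
Qed.

(** Reversing the coproduct reverses convolution, so the two notions of inverse
    agree. *)
Lemma conv2_cop (f g : E -> E -> k) x y : biform f -> biform g ->
  @conv2 k (cop E) f g x y = @conv2 k E g f x y.
Proof.
move=> bf bg; rewrite /conv2.
rewrite (@sw_copk (fun x1 x2 : E =>
  \sw_(y1, y2 <- @comul k (cop E) y) f x1 y1 * g x2 y2)); last by lin_tac.
apply: eq_sw => x1 x2.
rewrite (@sw_copk (fun y1 y2 : E => f x2 y1 * g x1 y2)); last by lin_tac.
by apply: eq_sw => y1 y2; rewrite mulrC.
Qed.

Lemma right_cocycle_copE : biform t ->
  (forall x y z : cop E,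
     \sw_(y1, y2 <- Δ y) \sw_(z1, z2 <- Δ z) t x (y1 * z1) * t y2 z2 =
     \sw_(x1, x2 <- Δ x) \sw_(y1, y2 <- Δ y) t (x1 * y1) z * t x2 y2) <->
  (forall x y z : E,
     \sw_(x1, x2 <- Δ x) \sw_(y1, y2 <- Δ y) t x1 y1 * t (x2 * y2) z =
     \sw_(y1, y2 <- Δ y) \sw_(z1, z2 <- Δ z) t y1 z1 * t x (y2 * z2)).
Proof.
move=> bt.
have el (x y z : E) :
    \sw_(y1, y2 <- @comul k (cop E) y) \sw_(z1, z2 <- @comul k (cop E) z)
      t x ((y1 : E) * z1) * t y2 z2 =
    \sw_(y1, y2 <- Δ y) \sw_(z1, z2 <- Δ z) t y1 z1 * t x (y2 * z2).
  rewrite (@sw_copk (fun y1 y2 : E => \sw_(z1, z2 <- @comul k (cop E) z)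
    t x (y1 * z1) * t y2 z2)); last by lin_tac.
  apply: eq_sw => y1 y2.
  rewrite (@sw_copk (fun z1 z2 : E => t x (y2 * z1) * t y1 z2)); last by lin_tac.
  by apply: eq_sw => z1 z2; rewrite mulrC.
have er (x y z : E) :
    \sw_(x1, x2 <- @comul k (cop E) x) \sw_(y1, y2 <- @comul k (cop E) y)
      t ((x1 : E) * y1) z * t x2 y2 =
    \sw_(x1, x2 <- Δ x) \sw_(y1, y2 <- Δ y) t x1 y1 * t (x2 * y2) z.
  rewrite (@sw_copk (fun x1 x2 : E => \sw_(y1, y2 <- @comul k (cop E) y)
    t (x1 * y1) z * t x2 y2)); last by lin_tac.
  apply: eq_sw => x1 x2.
  rewrite (@sw_copk (fun y1 y2 : E => t (x2 * y1) z * t x1 y2)); last by lin_tac.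
  by apply: eq_sw => y1 y2; rewrite mulrC.
split=> h x y z; first by rewrite -el -er; symmetry; apply: h.
apply: etrans (el x y z) _; rewrite -h; exact: esym (er x y z).
Qed.

Lemma right_cocycle_cop :
  @right_cocycle k (cop E) t <-> @left_cocycle k E t.
Proof.
split=> -[bt [g [bg tg gt]] ct t1r t1l]; split=> //.
- by exists g; split=> // x y; rewrite -conv2_cop.
- exact/right_cocycle_copE.
- by exists g; split=> // x y; rewrite conv2_cop.
- exact/right_cocycle_copE.
Qed.

End LeftTwist.

(** * The twisted tensor product of the two twisted algebras *)

Section TwistedTensorProduct.
Variables (k : fieldType) (C B : hopfType k) (ev : weakDuality C B).
Variables (sigma : B -> B -> k) (tau : C -> C -> k).
Notation mB := (right_twist sigma).
Notation mC := (left_twist tau).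

Definition twisted_tmul (s t : tens B C) : tens B C :=
  \sw_(b, c <- s) \sw_(b', c' <- t) \sw_(b'1, b'2 <- Δ b') \sw_(c1, c2 <- Δ c)
    ev c2 b'1 *: (mB b b'2 ⊗ mC c1 c').

Hypothesis (bs : biform sigma) (bt : biform tau).

Lemma twisted_tmul_bilin : bilin twisted_tmul.
Proof.
have bB := right_twist_bilin bs; have bC := left_twist_bilin bt.
apply: bilinI; rewrite /twisted_tmul => s; last by lin_tac2.
by apply: (@lin_swt _ _ _ _ _ _ (fun x => x)); lin_tac2.
Qed.

Lemma twisted_tmul_pure b c b' c' :
  twisted_tmul (b ⊗ c) (b' ⊗ c') =
  \sw_(b'1, b'2 <- Δ b') \sw_(c1, c2 <- Δ c) ev c2 b'1 *: (mB b b'2 ⊗ mC c1 c').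
Proof.
have bB := right_twist_bilin bs; have bC := left_twist_bilin bt.
by rewrite /twisted_tmul !sw_pure //; lin_tac2.
Qed.

(** Both bracketings of b ⊗ c, b' ⊗ c', b'' ⊗ c'' are the sum over Sweedler legs
    of ev(c'_(2), b''_(1)) ev(c_(2), b''_(2)) ev(c_(3), b'_(1)) times
    m_sigma(b, b'_(2), b''_(3)) ⊗ m_tau(c_(1), c'_(1), c''): colinearity of
    m_sigma or m_tau splits the outer pairing into a pairing with a product, and
    multiplicativity of ev breaks it in two. *)
Lemma twisted_tmulA : associative mB -> associative mC ->
  associative twisted_tmul.
Proof.
move=> aB aC.
have bB := right_twist_bilin bs; have bC := left_twist_bilin bt.
have bm := twisted_tmul_bilin; have [bl br] := bm.
move=> s t r; move: s; apply: tens_eqP; [by lin_tac | by lin_tac |].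
move=> b c; move: t; apply: tens_eqP; [by lin_tac | by lin_tac |].
move=> b' c'; move: r; apply: tens_eqP; [by lin_tac | exact: br |].
move=> b'' c''.
(* The common summand of the two bracketings. *)
pose K b'1 b'2 c'1 c'2 c1 c2 c3 g1 g2 g3 : tens B C :=
  ev c'2 g1 *: (ev c2 g2 *: (ev c3 b'1 *:
    (mB (mB b b'2) g3 ⊗ mC (mC c1 c'1) c''))).
transitivity (\sw_(b'1, b'2 <- Δ b') \sw_(c'1, c'2 <- Δ c')
  \sw_(c1, x <- Δ c) \sw_(c2, c3 <- Δ x)
  \sw_(g1, y <- Δ b'') \sw_(g2, g3 <- Δ y)
    K b'1 b'2 c'1 c'2 c1 c2 c3 g1 g2 g3).
  (* The inner product is on the right: split the left pairing by colinearity of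
     m_sigma. *)
  rewrite twisted_tmul_pure (lin_sw _ _ (br _)).
  transitivity (\sw_(g1, y <- Δ b'') \sw_(c'1, c'2 <- Δ c')
    \sw_(b'1, b'2 <- Δ b') \sw_(g2, g3 <- Δ y)
    \sw_(c1, x <- Δ c) \sw_(c2, c3 <- Δ x)
      K b'1 b'2 c'1 c'2 c1 c2 c3 g1 g2 g3).
    apply: eq_sw => g1 y; rewrite (lin_sw _ _ (br _)); apply: eq_sw => c'1 c'2.
    rewrite (linZ (br _)) twisted_tmul_pure comul_right_twist //; last by lin_tac2.
    rewrite -swZ; apply: eq_sw => b'1 b'2.
    rewrite -swZ; apply: eq_sw => g2 g3.
    rewrite -swZ; apply: eq_sw => c1 x.
    by rewrite pairingMr_sw -swZ; apply: eq_sw => c2 c3; rewrite aB aC.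
  rewrite exch_sw; under eq_sw => c'1 c'2 do rewrite exch_sw.
  rewrite exch_sw; apply: eq_sw => b'1 b'2; apply: eq_sw => c'1 c'2.
  transitivity (\sw_(g1, y <- Δ b'') \sw_(c1, x <- Δ c) \sw_(c2, c3 <- Δ x)
    \sw_(g2, g3 <- Δ y) K b'1 b'2 c'1 c'2 c1 c2 c3 g1 g2 g3).
    apply: eq_sw => g1 y; rewrite exch_sw; apply: eq_sw => c1 x.
    by rewrite exch_sw.
  by rewrite exch_sw; apply: eq_sw => c1 x; rewrite exch_sw.
(* The inner product is on the left: split by colinearity of m_tau, which leaves
   both threefold coproducts bracketed the other way. *)
symmetry; rewrite twisted_tmul_pure (lin_sw _ _ (bl _)).
apply: eq_sw => b'1 b'2; rewrite (lin_sw _ _ (bl _)).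
transitivity (\sw_(x, c3 <- Δ c) \sw_(y, g3 <- Δ b'')
    \sw_(c1, c2 <- Δ x) \sw_(c'1, c'2 <- Δ c') \sw_(g1, g2 <- Δ y)
      K b'1 b'2 c'1 c'2 c1 c2 c3 g1 g2 g3).
  apply: eq_sw => x c3; rewrite (linZ (bl _)) twisted_tmul_pure.
  rewrite -swZ; apply: eq_sw => y g3.
  rewrite comul_left_twist //; last by lin_tac2.
  rewrite -swZ; apply: eq_sw => c1 c2.
  rewrite -swZ; apply: eq_sw => c'1 c'2.
  rewrite pairingMl_sw -swZ; apply: eq_sw => g1 g2.
  by rewrite /K !scalerA; congr (_ *: _); rewrite [RHS]mulrC mulrA.
transitivity (\sw_(c'1, c'2 <- Δ c') \sw_(x, c3 <- Δ c) \sw_(c1, c2 <- Δ x)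
    \sw_(y, g3 <- Δ b'') \sw_(g1, g2 <- Δ y)
      K b'1 b'2 c'1 c'2 c1 c2 c3 g1 g2 g3).
  rewrite [RHS]exch_sw; apply: eq_sw => x c3.
  rewrite [RHS]exch_sw exch_sw; apply: eq_sw => c1 c2.
  by rewrite exch_sw.
apply: eq_sw => c'1 c'2.
rewrite (@sw_comulA _ _ _ (fun c1 c2 c3 => \sw_(y, g3 <- Δ b'')
   \sw_(g1, g2 <- Δ y) K b'1 b'2 c'1 c'2 c1 c2 c3 g1 g2 g3)); last first.
  by rewrite /K; split=> ? ?; lin_tac2.
apply: eq_sw => c1 x; apply: eq_sw => c2 c3.
rewrite (@sw_comulA _ _ _ (K b'1 b'2 c'1 c'2 c1 c2 c3)) //.
by rewrite /K; split=> ? ?; lin_tac2.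
Qed.

Lemma twisted_tmul1l : left_id 1 mB -> left_id 1 mC ->
  left_id (1 ⊗ 1) twisted_tmul.
Proof.
move=> uB uC; have [bl br] := twisted_tmul_bilin.
have bB := right_twist_bilin bs; have bC := left_twist_bilin bt.
apply: tens_eqP; [exact: br | by [] |] => b c.
rewrite twisted_tmul_pure -[in RHS](counitl b).
rewrite (lin_sw _ _ (bilinl (@tpure_bilin k B C) _)); apply: eq_sw => b1 b2.
rewrite comul1 sw_pure; last by lin_tac2.
by rewrite pairing1l uB uC (linZ (bilinl (@tpure_bilin k B C) _)).
Qed.

Lemma twisted_tmul1r : right_id 1 mB -> right_id 1 mC ->
  right_id (1 ⊗ 1) twisted_tmul.
Proof.
move=> uB uC; have [bl br] := twisted_tmul_bilin.
have bB := right_twist_bilin bs; have bC := left_twist_bilin bt.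
apply: tens_eqP; [exact: bl | by [] |] => b c.
rewrite twisted_tmul_pure comul1 sw_pure; last by lin_tac2.
rewrite -[in RHS](counitr c).
rewrite (lin_sw _ _ (bilinr (@tpure_bilin k B C) _)); apply: eq_sw => c1 c2.
by rewrite pairing1r uB uC (linZ (bilinr (@tpure_bilin k B C) _)).
Qed.

End TwistedTensorProduct.

(** * The Drinfeld double as a coalgebra over its two factors *)

Section DrinCoalgebra.
Variables (k : fieldType) (C B : hopfType k) (ev : weakDuality C B).
Notation D := (Drin ev).
Notation iB := (drinB ev).
Notation iC := (drinC ev).

Lemma drin_eqP (W : lmodType k) (f g : D -> W) : lin f -> lin g ->
  (forall b c, f (iB b * iC c) = g (iB b * iC c)) -> f =1 g.
Proof.
move=> lf lg h x; rewrite -[x]drin_coordK.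
apply: (@tens_eqP k B C W (fun t => f (drin_pbw ev t)) (fun t => g (drin_pbw ev t))).
- exact: lin_cmp lf (@lin_drin_pbw k C B ev).
- exact: lin_cmp lg (@lin_drin_pbw k C B ev).
by move=> b c; rewrite drin_pbw_pure.
Qed.

Lemma sw_drin_coord (W : lmodType k) (f : B -> C -> W) b c : bilin f ->
  sweedler f (drin_coord (iB b * iC c)) = f b c.
Proof. by move=> bf; rewrite -drin_pbw_pure drin_pbwK sw_pure. Qed.

Lemma sw_drin_comul (W : lmodType k) (f : D -> D -> W) b c : bilin f ->
  sweedler f (Δ (iB b * iC c)) =
  \sw_(b1, b2 <- Δ b) \sw_(c1, c2 <- Δ c) f (iB b1 * iC c2) (iB b2 * iC c1).
Proof.
move=> bf; rewrite comulM_sw //.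
pose H (s t : tens D D) := \sw_(x1, x2 <- s) \sw_(y1, y2 <- t) f (x1 * y1) (x2 * y2).
transitivity (H (comulB ev b) (comulC ev c)).
  by rewrite -drin_comul_B -drin_comul_C.
have bi x1 x2 : bilin (fun y1 y2 => f (x1 * y1) (x2 * y2)) by lin_tac.
have bo t : bilin (fun x1 x2 => \sw_(y1, y2 <- t) f (x1 * y1) (x2 * y2)) by lin_tac.
rewrite /H /comulB (lin_sw _ _ (sw_lin (bo _))); apply: eq_sw => b1 b2.
rewrite sw_pure // /comulC (lin_sw _ _ (sw_lin (bi _ _))).
by apply: eq_sw => c1 c2; rewrite sw_pure.
Qed.

(** The exchange relation applied inside threefold coproducts of b and c; N
    gathers the surrounding factors, which depend on the two legs that the
    relation leaves alone. *)
Lemma drin_exchange_tails (W : lmodType k) (N : C -> B -> D -> W) b c :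
  trilin N ->
  \sw_(b1, b' <- Δ b) \sw_(c', c3 <- Δ c)
    \sw_(b2, b3 <- Δ b') \sw_(c1, c2 <- Δ c')
      ev c2 b2 *: N c1 b3 (iC c3 * iB b1) =
  \sw_(b1, b' <- Δ b) \sw_(c', c3 <- Δ c)
    \sw_(b2, b3 <- Δ b') \sw_(c1, c2 <- Δ c')
      ev c3 b1 *: N c1 b3 (iB b2 * iC c2).
Proof.
case=> N1 N2 N3; have lN c1 b3 : lin (N c1 b3) by [].
rewrite (@sw_comulA2_opp k B C W (fun b1 b2 b3 c1 c2 c3 =>
  ev c2 b2 *: N c1 b3 (iC c3 * iB b1))); first last.
- by split=> ? ?; lin_tac2 => //; apply: lin_cmp (N3 _ _) _; lin_tac2.
- by split=> ? ?; lin_tac2 => //; apply: lin_cmp (N3 _ _) _; lin_tac2.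
rewrite (@sw_comulA2_opp k B C W (fun b1 b2 b3 c1 c2 c3 =>
  ev c3 b1 *: N c1 b3 (iB b2 * iC c2))); first last.
- by split=> ? ?; lin_tac2 => //; apply: lin_cmp (N3 _ _) _; lin_tac2.
- by split=> ? ?; lin_tac2 => //; apply: lin_cmp (N3 _ _) _; lin_tac2.
apply: eq_sw => b' b3; apply: eq_sw => c1 c'; symmetry.
have := congr1 (N c1 b3) (drin_exchange ev b' c').
rewrite !(lin_sw _ _ (lN _ _)) => exch.
transitivity (\sw_(b1, b2 <- Δ b') N c1 b3
    (\sw_(c2, c3 <- Δ c') ev c3 b1 *: (iB b2 * iC c2))).
  apply: eq_sw => b1 b2; rewrite (lin_sw _ _ (lN _ _)).
  by apply: eq_sw => c2 c3; rewrite (linZ (lN _ _)).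
rewrite exch; apply: eq_sw => b1 b2; rewrite (lin_sw _ _ (lN _ _)).
by apply: eq_sw => c2 c3; rewrite (linZ (lN _ _)).
Qed.

Definition drin_projB (x : D) : B := \sw_(b, c <- drin_coord x) ε c *: b.
(** The target is the co-opposite of C so that the projection is a coalgebra
    morphism. *)
Definition drin_projC (x : D) : cop C := \sw_(b, c <- drin_coord x) ε b *: c.

Lemma lin_drin_projB : lin drin_projB.
Proof. by apply: lin_swt; [lin_tac | exact: lin_drin_coord]. Qed.
Lemma lin_drin_projC : lin drin_projC.
Proof. by apply: lin_swt; [lin_tac | exact: lin_drin_coord]. Qed.

Lemma drin_projB_pbw b c : drin_projB (iB b * iC c) = ε c *: b.
Proof. by apply: sw_drin_coord; lin_tac. Qed.
Lemma drin_projC_pbw b c : drin_projC (iB b * iC c) = ε b *: c.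
Proof. by apply: (@sw_drin_coord C); lin_tac. Qed.

Lemma drin_counit_pbw b c : ε (iB b * iC c : D) = ε b * ε c :> k.
Proof.
rewrite counitM; congr (_ * _); first exact: drin_counit_B.
exact: drin_counit_C.
Qed.

Lemma coalg_morph_drin_projB : coalg_morph drin_projB.
Proof.
have lp := lin_drin_projB; have tl := bilinl (@tpure_bilin k B B).
have tr := bilinr (@tpure_bilin k B B).
split=> //; [apply: drin_eqP | apply: (@drin_eqP k^o)].
- by lin_tac.
- by lin_tac.
- move=> b c; rewrite sw_drin_comul; last by lin_tac.
  rewrite drin_projB_pbw (linZ (@lin_comul k B)) -[in LHS](sw_id (Δ b)) -swZ.
  apply: eq_sw => b1 b2.
  rewrite -(@sw_counitl _ _ _ (fun z => (ε z : k) *: (b1 ⊗ b2))); last by lin_tac.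
  apply: eq_sw => c1 c2; rewrite !drin_projB_pbw (linZ (tl _)) (linZ (tr _)).
  by rewrite !scalerA mulrC.
- exact: (lin_cmp (W := k^o) (@lin_counit k B) lp).
- exact: (@lin_counit k D).
- move=> b c; rewrite drin_projB_pbw (linZ (@lin_counit k B)) drin_counit_pbw.
  by rewrite [LHS]mulrC.
Qed.

Lemma coalg_morph_drin_projC : coalg_morph drin_projC.
Proof.
have lp := lin_drin_projC; have tl := bilinl (@tpure_bilin k (cop C) (cop C)).
have tr := bilinr (@tpure_bilin k (cop C) (cop C)).
split=> //; [apply: drin_eqP | apply: (@drin_eqP k^o)].
- by lin_tac.
- by lin_tac.
- move=> b c; rewrite sw_drin_comul; last by lin_tac.
  rewrite drin_projC_pbw (linZ (@lin_comul k (cop C))).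
  rewrite exch_sw [Δ _](_ : _ = cop_comul c) // /cop_comul -swZ.
  apply: eq_sw => c1 c2.
  rewrite -(@sw_counitl _ _ _
    (fun z => (ε z : k) *: ((c2 : cop C) ⊗ (c1 : cop C)))); last by lin_tac.
  apply: eq_sw => b1 b2; rewrite !drin_projC_pbw (linZ (tl _)) (linZ (tr _)).
  by [].
- exact: (lin_cmp (W := k^o) (@lin_counit k (cop C)) lp).
- exact: (@lin_counit k D).
- by move=> b c; rewrite drin_projC_pbw (linZ (@lin_counit k (cop C))) drin_counit_pbw.
Qed.

(** The projections recover the coordinates: (p ⊗ q) ∘ Δ sends bc to b ⊗ c. *)
Lemma sw_drin_proj (W : lmodType k) (f : B -> C -> W) b c : bilin f ->
  \sw_(x1, x2 <- Δ (iB b * iC c)) f (drin_projB x1) (drin_projC x2) = f b c.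
Proof.
move=> bf; have lp := lin_drin_projB; have lq := lin_drin_projC.
rewrite sw_drin_comul; last by lin_tac.
rewrite -(@sw_counitr _ _ _ (f^~ c)); last exact: bilinl.
apply: eq_sw => b1 b2.
rewrite -(@sw_counitr _ _ _ (f b1)); last exact: bilinr.
rewrite -swZ; apply: eq_sw => c1 c2; rewrite drin_projB_pbw drin_projC_pbw.
by rewrite (linZ (bilinl bf _)) (linZ (bilinr bf _)) !scalerA mulrC.
Qed.

(** The inverse of ev is ev ∘ (S ⊗ id): the convolution over the co-opposite of C
    pairs b with S c_(1) c_(2), or with c_(1) S c_(2). *)
Lemma conv_invertible_pairing : @conv_invertible k (cop C) B ev.
Proof.
have bev := pairing_bilin ev; exists (fun c b => ev (antipode c) b).
split=> [|c b|c b]; first by lin_tac.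
- rewrite /conv (@sw_copk k C (fun c1 c2 => \sw_(b1, b2 <- Δ b)
    ev c1 b1 * ev (antipode c2) b2)); last by lin_tac.
  transitivity (\sw_(c1, c2 <- Δ (c : C)) ev (antipode c1 * c2) b).
    apply: eq_sw => c1 c2; rewrite pairingMl.
    by apply: eq_sw => b1 b2; rewrite mulrC.
  rewrite (@sw_antipodel k C k^o (fun z => ev z b)); last by lin_tac.
  by rewrite pairing1l.
- rewrite /conv (@sw_copk k C (fun c1 c2 => \sw_(b1, b2 <- Δ b)
    ev (antipode c1) b1 * ev c2 b2)); last by lin_tac.
  transitivity (\sw_(c1, c2 <- Δ (c : C)) ev (c1 * antipode c2) b).
    apply: eq_sw => c1 c2; rewrite pairingMl.
    by apply: eq_sw => b1 b2; rewrite mulrC.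
  rewrite (@sw_antipoder k C k^o (fun z => ev z b)); last by lin_tac.
  by rewrite pairing1l.
Qed.

End DrinCoalgebra.

(** * The cocycle on the Drinfeld double *)

Section CocycleComp.
Variables (k : fieldType) (C B : hopfType k) (ev : weakDuality C B).
Variables (sigma : B -> B -> k) (tau : C -> C -> k).
Hypothesis (bs : biform sigma) (bt : biform tau).
Notation D := (Drin ev).
Notation iB := (drinB ev).
Notation iC := (drinC ev).
Notation chi := (@cocycle_comp k C B ev sigma tau).
Notation pB := (@drin_projB k C B ev).
Notation pC := (@drin_projC k C B ev).

Lemma cocycle_comp_biform : biform chi.
Proof.
have lc := @lin_drin_coord k C B ev.
split=> [y|x]; rewrite /cocycle_comp.
  by apply: (@lin_swtk k _ _ _ _ (@drin_coord k C B ev)) => //; lin_tac2.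
apply: lin_swfk => b c.
by apply: (@lin_swtk k _ _ _ _ (@drin_coord k C B ev)) => //; lin_tac2.
Qed.

Lemma cocycle_comp_pbw b b' c c' :
  chi (iB b * iC c) (iB b' * iC c') =
  \sw_(b'1, b'2 <- Δ b') \sw_(c1, c2 <- Δ c)
    sigma b b'2 * tau c1 c' * ev c2 b'1.
Proof.
rewrite /cocycle_comp (@sw_drin_coord k C B ev k^o); last by lin_tac2.
by rewrite (@sw_drin_coord k C B ev k^o) //; lin_tac2.
Qed.

(** The last two factors multiply to sigma ⊗ tau at bc, b'c'; the first then only
    meets the legs c_(2) and b'_(1). *)
Lemma cocycle_comp_conv :
  conv (fun x y => ev (pC x) (pB y))
    (conv (fun x y => sigma (pB x) (pB y)) (fun x y => tau (pC x) (pC y)))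
  =2 chi.
Proof.
have lp := @lin_drin_projB k C B ev; have lq := @lin_drin_projC k C B ev.
have bev := pairing_bilin ev.
pose f1 x y := ev (pC x) (pB y).
pose f2 x y := sigma (pB x) (pB y).
pose f3 x y := tau (pC x) (pC y).
have b1 : biform f1 by rewrite /f1; lin_tac.
have b2 : biform f2 by rewrite /f2; lin_tac.
have b3 : biform f3 by rewrite /f3; lin_tac.
have b23 := conv_biform b2 b3.
have bl := conv_biform b1 b23.
have bc := cocycle_comp_biform.
move=> x y; rewrite -/f1 -/f2 -/f3.
move: x; apply: (@drin_eqP k C B ev k^o); [exact: bilinl | exact: bilinl |].
move=> b c; move: y; apply: (@drin_eqP k C B ev k^o); [exact: bilinr | exact: bilinr |].
move=> b' c'; rewrite cocycle_comp_pbw.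
have e23 u v u' v' : conv f2 f3 (iB u * iC v) (iB u' * iC v') =
    sigma u u' * tau v v'.
  transitivity (\sw_(x1, x2 <- Δ (iB u * iC v)) sigma (pB x1) u' * tau (pC x2) v').
    apply: eq_sw => x1 x2.
    apply: (@sw_drin_proj k C B ev k^o
      (fun z w => sigma (pB x1) z * tau (pC x2) w)).
    by lin_tac.
  by apply: (@sw_drin_proj k C B ev k^o (fun z w => sigma z u' * tau w v')); lin_tac.
rewrite {1}/conv (@sw_drin_comul k C B ev k^o); last by lin_tac.
transitivity (\sw_(u1, u2 <- Δ b) (ε u1 : k) *
    \sw_(b'1, b'2 <- Δ b') \sw_(c1, c2 <- Δ c)
      sigma u2 b'2 * tau c1 c' * ev c2 b'1); last first.
  by apply: (@sw_counitlk k B (fun z => \sw_(b'1, b'2 <- Δ b') \sw_(c1, c2 <- Δ c)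
    sigma z b'2 * tau c1 c' * ev c2 b'1)); lin_tac.
apply: eq_sw => u1 u2; rewrite exch_sw -sw_mull; apply: eq_sw => c1 c2.
rewrite (@sw_drin_comul k C B ev k^o); last by lin_tac.
rewrite -sw_mull; apply: eq_sw => v1 v2.
rewrite -(@sw_counitrk _ _ (fun z => sigma u2 v2 * tau c1 z * ev c2 v1)); last by lin_tac.
rewrite -sw_mull; apply: eq_sw => w1 w2.
rewrite e23 /f1 drin_projC_pbw drin_projB_pbw.
have -> : ev (ε u1 *: c2) (ε w2 *: v1) = ε u1 * (ε w2 * ev c2 v1).
  by rewrite (linZ (bilinl bev _)) (linZ (bilinr bev _)).
by rewrite -!mulrA; do 2 congr (_ * _); rewrite mulrC -mulrA.
Qed.

Lemma cocycle_comp_invertible :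
  conv2_invertible sigma -> @conv2_invertible k (cop C) tau ->
  conv2_invertible chi.
Proof.
move=> is_ it; have hp := coalg_morph_drin_projB ev.
have hq := coalg_morph_drin_projC ev; have bev := pairing_bilin ev.
have lp := coalg_morph_lin hp; have lq := coalg_morph_lin hq.
apply: eq_conv_invertible cocycle_comp_conv _.
have b2 := biform_pullback lp lp bs; have b3 := biform_pullback lq lq bt.
apply: conv_invertible_conv.
- exact: (biform_pullback lq lp bev).
- exact: conv_biform.
- exact: (conv_invertible_pullback hq hp bev (conv_invertible_pairing ev)).
apply: conv_invertible_conv => //.
- exact: (conv_invertible_pullback hp hp bs is_).
- exact: (conv_invertible_pullback hq hq bt it).
Qed.

(** The twisted product is the sum of sigma(b_(2), b'_(3)) tau(c_(1), c'_(1)) times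
    b_(1) (ev(c_(2), b'_(2)) c_(3) b'_(1)) c'_(2), and the exchange relation moves
    the middle c past the middle b'. *)
Lemma right_twist_pbw b c b' c' :
  right_twist chi (iB b * iC c) (iB b' * iC c') =
  drin_pbw ev (twisted_tmul ev sigma tau (b ⊗ c) (b' ⊗ c')).
Proof.
have bchi := cocycle_comp_biform; have bev := pairing_bilin ev.
have lpbw := @lin_drin_pbw k C B ev.
rewrite {1}/right_twist sw_drin_comul; last by lin_tac.
rewrite twisted_tmul_pure // (lin_sw _ _ lpbw).
(* The factors around the product to be exchanged. *)
pose N b1 b2 d1 d2 e1 g3 (z : D) : D :=
  sigma b2 g3 *: (tau e1 d1 *: (iB b1 * z * iC d2)).
have lN b1 b2 d1 d2 : trilin (N b1 b2 d1 d2).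
  by rewrite /N; split=> ? ?; lin_tac2.
transitivity (\sw_(b1, b2 <- Δ b) \sw_(d1, d2 <- Δ c')
    \sw_(g1, g <- Δ b') \sw_(e, e3 <- Δ c)
    \sw_(g2, g3 <- Δ g) \sw_(e1, e2 <- Δ e)
      ev e2 g2 *: N b1 b2 d1 d2 e1 g3 (iC e3 * iB g1)).
  apply: eq_sw => b1 b2.
  transitivity (\sw_(e, e3 <- Δ c) \sw_(g1, g <- Δ b') \sw_(d1, d2 <- Δ c')
    \sw_(g2, g3 <- Δ g) \sw_(e1, e2 <- Δ e)
      ev e2 g2 *: N b1 b2 d1 d2 e1 g3 (iC e3 * iB g1)).
    apply: eq_sw => e e3; rewrite sw_drin_comul; last by lin_tac.
    apply: eq_sw => g1 g; apply: eq_sw => d1 d2.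
    rewrite cocycle_comp_pbw -sw_scalel; apply: eq_sw => g2 g3.
    rewrite -sw_scalel; apply: eq_sw => e1 e2.
    by rewrite /N !scalerA !mulrA; congr (_ *: _); rewrite [LHS]mulrC mulrA.
  rewrite [RHS]exch_sw exch_sw; apply: eq_sw => g1 g; rewrite exch_sw.
  by [].
under eq_sw => b1 b2 do under eq_sw => d1 d2 do rewrite drin_exchange_tails //.
transitivity (\sw_(g1, g <- Δ b') \sw_(b1, b2 <- Δ b) \sw_(d1, d2 <- Δ c')
    \sw_(e, e3 <- Δ c) \sw_(g2, g3 <- Δ g) \sw_(e1, e2 <- Δ e)
      ev e3 g1 *: N b1 b2 d1 d2 e1 g3 (iB g2 * iC e2)).
  by rewrite [RHS]exch_sw; apply: eq_sw => b1 b2; rewrite [RHS]exch_sw.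
apply: eq_sw => g1 g; rewrite (lin_sw _ _ lpbw).
transitivity (\sw_(e, e3 <- Δ c) \sw_(b1, b2 <- Δ b) \sw_(d1, d2 <- Δ c')
    \sw_(g2, g3 <- Δ g) \sw_(e1, e2 <- Δ e)
      ev e3 g1 *: N b1 b2 d1 d2 e1 g3 (iB g2 * iC e2)).
  by rewrite [RHS]exch_sw; apply: eq_sw => b1 b2; rewrite [RHS]exch_sw.
apply: eq_sw => e e3; rewrite (linZ lpbw) drin_pbw_pure.
transitivity (\sw_(b1, b2 <- Δ b) \sw_(g2, g3 <- Δ g)
    \sw_(e1, e2 <- Δ e) \sw_(d1, d2 <- Δ c')
      ev e3 g1 *: N b1 b2 d1 d2 e1 g3 (iB g2 * iC e2)).
  apply: eq_sw => b1 b2; rewrite exch_sw; apply: eq_sw => g2 g3.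
  by rewrite exch_sw.
(* What remains is the expansion of the product of m_sigma(b, g) and m_tau(e, c'),
   one factor at a time. *)
pose M z := iB z * iC (left_twist tau e c').
have lM : lin M by rewrite /M; lin_tac2.
rewrite -/(M _) /right_twist (lin_sw _ _ lM) -swZ; apply: eq_sw => b1 b2.
rewrite (lin_sw _ _ lM) -swZ; apply: eq_sw => g2 g3; rewrite (linZ lM) /M.
pose L z := iB (b1 * g2) * iC z.
have lL : lin L by rewrite /L; lin_tac2.
rewrite -/(L _) /left_twist (lin_sw _ _ lL) -!swZ; apply: eq_sw => e1 e2.
rewrite (lin_sw _ _ lL) -!swZ; apply: eq_sw => d1 d2.
by rewrite (linZ lL) /L /N drinBM drinCM !mulrA.
Qed.

Lemma drin_twistE : drin_twist ev sigma tau =2 twisted_tmul ev sigma tau.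
Proof.
have bchi := cocycle_comp_biform.
have bm := right_twist_bilin bchi; have bt' := twisted_tmul_bilin ev bs bt.
have lpbw := @lin_drin_pbw k C B ev; have lco := @lin_drin_coord k C B ev.
move=> s t; rewrite /drin_twist; move: s; apply: tens_eqP.
- by lin_tac.
- by lin_tac.
move=> b c; move: t; apply: tens_eqP.
- by lin_tac.
- exact: bilinr bt' _.
by move=> b' c'; rewrite !drin_pbw_pure right_twist_pbw drin_pbwK.
Qed.

Lemma right_twist_drinA :
  associative (right_twist sigma) -> associative (left_twist tau) ->
  associative (right_twist chi).
Proof.
move=> aB aC x y z.
have tw s t : right_twist chi (drin_pbw ev s) (drin_pbw ev t) =
    drin_pbw ev (twisted_tmul ev sigma tau s t).
  by rewrite -drin_twistE /drin_twist drin_coordK.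
rewrite -[x]drin_coordK -[y]drin_coordK -[z]drin_coordK !tw.
by rewrite twisted_tmulA.
Qed.

Lemma cocycle_comp1r x : (forall b, sigma b 1 = ε b) ->
  (forall c, tau c 1 = ε c) -> chi x 1 = ε x.
Proof.
move=> s1 t1; have bchi := cocycle_comp_biform.
move: x; apply: (@drin_eqP k C B ev k^o).
- exact: bilinl bchi 1.
- exact: (@lin_counit k D).
move=> b c; rewrite -[1](mulr1 (iB 1)) -(drinC1 ev) cocycle_comp_pbw.
rewrite drin_counit_pbw comul1 (@sw_pure k B B k^o); last by lin_tac2.
rewrite -(@sw_counitrk _ _ (fun c => ε b * ε c) c); last by lin_tac.
apply: eq_sw => c1 c2; rewrite s1 t1 pairing1r.
by rewrite mulrC.
Qed.

Lemma cocycle_comp1l x : (forall b, sigma 1 b = ε b) ->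
  (forall c, tau 1 c = ε c) -> chi 1 x = ε x.
Proof.
move=> s1 t1; have bchi := cocycle_comp_biform.
move: x; apply: (@drin_eqP k C B ev k^o).
- exact: bilinr bchi 1.
- exact: (@lin_counit k D).
move=> b c; rewrite -[1](mulr1 (iB 1)) -(drinC1 ev) cocycle_comp_pbw.
rewrite drin_counit_pbw -(@sw_counitlk _ _ (fun b => ε b * ε c) b); last by lin_tac.
apply: eq_sw => b1 b2; rewrite comul1 (@sw_pure k C C k^o); last by lin_tac2.
by rewrite s1 t1 pairing1l mulrC.
Qed.

End CocycleComp.

Theorem theorem4p7 (k : fieldType) (C B : hopfType k) (ev : weakDuality C B)
    (sigma : B -> B -> k) (tau : C -> C -> k) :
  (@right_cocycle k (cop C) tau <-> @left_cocycle k C tau) /\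
  (@right_cocycle k B sigma -> @right_cocycle k (cop C) tau ->
   [/\ forall (b b' : B) (c c' : C),
         cocycle_comp sigma tau (drinB ev b * drinC ev c)
                                (drinB ev b' * drinC ev c') =
         \sw_(b'1, b'2 <- Δ b') \sw_(c1, c2 <- Δ c)
            sigma b b'2 * tau c1 c' * ev c2 b'1,
       @right_cocycle k (Drin ev) (cocycle_comp sigma tau),
       algebra_product (drin_twist ev sigma tau) (1 ⊗ 1)
     & forall (b b' : B) (c c' : C),
         drin_twist ev sigma tau (b ⊗ c) (b' ⊗ c') =
         \sw_(b'1, b'2 <- Δ b') \sw_(c1, c2 <- Δ c)
            ev c2 b'1 *: (right_twist sigma b b'2 ⊗ left_twist tau c1 c')]).
Proof.
split; first exact: right_cocycle_cop.
move=> hs ht; have [bs is_ _ s1r s1l] := hs; have [bt it _ t1r t1l] := ht.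
have btC : @biform k C C tau by [].
have e x y : @right_twist k (cop C) tau x y = @left_twist k C tau x y.
  exact: left_twist_cop.
have aB := right_twistA hs.
have aC : associative (@left_twist k C tau).
  by move=> x y z; rewrite -!e; exact: right_twistA ht _ _ _.
have uCl : left_id 1 (@left_twist k C tau).
  by move=> x; rewrite -e; exact: right_twist1l ht _.
have uCr : right_id 1 (@left_twist k C tau).
  by move=> x; rewrite -e; exact: right_twist1r ht _.
have bchi := @cocycle_comp_biform k C B ev sigma tau bs btC.
split.
- by move=> b b' c c'; exact: cocycle_comp_pbw.
- split=> //.
  + exact: cocycle_comp_invertible.
  + by apply: right_twistA_cocycle => //; exact: right_twist_drinA.
  + by move=> x; exact: cocycle_comp1r.
  + by move=> x; exact: cocycle_comp1l.
- have tE := drin_twistE ev bs btC.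
  have bm := twisted_tmul_bilin ev bs btC.
  split.
  + by split=> [t|s] a u v; rewrite !tE; [exact: (bilinl bm) | exact: (bilinr bm)].
  + by move=> x y z; rewrite !tE; exact: twisted_tmulA.
  + by move=> x; rewrite tE; apply: twisted_tmul1l => //; exact: right_twist1l.
  + by move=> x; rewrite tE; apply: twisted_tmul1r => //; exact: right_twist1r.
- by move=> b b' c c'; rewrite drin_twistE // twisted_tmul_pure.
Qed.
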